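(* Let $k$ be a field and let $R=k[a,b,c]$ with the standard grading. Consider the two monomial ideals $$I=(a^3,b^3,c^3,bc^2,a^2bc,a^2b^2),\qquad J=(a^3,b^3,c^3,bc^2,a^2c^2,a^2b^2).$$ Then $R/I$ and $R/J$ have the same graded Betti numbers, namely (all graded Betti numbers not listed being $0$) $$\beta_{0,0}=1,\quad \beta_{1,3}=4,\ \beta_{1,4}=2,\quad \beta_{2,4}=1,\ \beta_{2,5}=6,\ \beta_{2,6}=1,\quad \beta_{3,6}=1,\ \beta_{3,7}=2,$$ but $I$ is licci whereas $J$ is not licci.
   Context: For a graded ideal $I$ of a standard graded polynomial ring $R$ over $k$, $\beta_{i,j}=\beta_{i,j}(R/I)=\dim_k \operatorname{Tor}^R_i(R/I,k)_j$; the Betti table of $R/I$ is the array of these numbers. Two proper ideals $I,I'$ of $R$ are (directly) linked if there is an ideal $\mathfrak c\subseteq I\cap I'$ generated by a regular sequence (a complete intersection) such that $I'=\mathfrak c:I$ and $I=\mathfrak c:I'$. An ideal is licci if it is in the linkage class of a complete intersection, i.e. it can be joined to a complete intersection ideal by a finite sequence of direct links. *)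

(* Defs.v *)
From HB Require Import structures.
From mathcomp Require Import all_boot all_order all_algebra.
From mathcomp Require Import mpoly.
From Stdlib Require Import Relation_Operators.

Set Implicit Arguments.
Unset Strict Implicit.
Unset Printing Implicit Defensive.

Import GRing.Theory.
Local Open Scope ring_scope.

(* Ideals are Prop-valued predicates, because membership in an arbitrary ideal
   or colon ideal need not be decidable; equality of ideals is [eq_ideal]. *)
Section Ideals.
Variable R : comNzRingType.
Implicit Types (I J C : R -> Prop) (s : seq R).

Definition is_ideal I : Prop :=
  [/\ I 0, forall x y, I x -> I y -> I (x + y) & forall r x, I x -> I (r * x)].

Definition proper_ideal I : Prop := is_ideal I /\ ~ I 1.

Definition sub_ideal I J : Prop := forall x, I x -> J x.

Definition eq_ideal I J : Prop := forall x, I x <-> J x.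

Definition ideal_gen s : R -> Prop :=
  fun x => exists r : 'I_(size s) -> R, x = \sum_(i < size s) r i * s`_i.

Definition colon C I : R -> Prop := fun x => forall y, I y -> C (x * y).

Definition regular_sequence s : Prop :=
  (forall i, (i < size s)%N ->
     forall x, ideal_gen (take i s) (s`_i * x) -> ideal_gen (take i s) x)
  /\ ~ ideal_gen s 1.

Definition complete_intersection I : Prop :=
  exists2 s, regular_sequence s & eq_ideal I (ideal_gen s).

Definition directly_linked I J : Prop :=
  [/\ proper_ideal I, proper_ideal J &
      exists C, [/\ complete_intersection C, sub_ideal C I, sub_ideal C J,
                    eq_ideal J (colon C I) & eq_ideal I (colon C J)]].

(* [directly_linked] is symmetric, so its reflexive transitive closure is the
   equivalence relation whose classes are the linkage classes. *)
Definition licci I : Prop :=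
  exists2 C, complete_intersection C
           & clos_refl_trans (R -> Prop) directly_linked I C.

End Ideals.

Section GradedBetti.
Variables (k : fieldType) (n : nat).
Local Notation R := {mpoly k[n]}.

(* Data of a complex  ... -> F_1 -> F_0 -> R/I  of finitely generated graded
   free modules: F_i is the module of row vectors 'rV[R]_(fr_rank i), whose
   s-th basis vector has degree fr_deg i s; the map F_(i+1) -> F_i is
   u |-> u *m fr_diff i; the s-th basis vector of F_0 is sent to the class
   modulo I of fr_aug s. *)
Record free_data := FreeData {
  fr_rank : nat -> nat;
  fr_deg : forall i, 'I_(fr_rank i) -> int;
  fr_diff : forall i, 'M[R]_(fr_rank i.+1, fr_rank i);
  fr_aug : 'cV[R]_(fr_rank 0)
}.

Implicit Types (F : free_data) (I : R -> Prop).

(* All the maps preserve degrees. *)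
Definition fr_homogeneous F : Prop :=
  (forall i s t m, m \in msupp (fr_diff F i s t) ->
     fr_deg s = (mdeg m)%:Z + fr_deg t)
  /\ (forall s m, m \in msupp (fr_aug F s 0) -> fr_deg s = (mdeg m)%:Z).

(* Exactness of  ... -> F_1 -> F_0 -> R/I -> 0. *)
Definition fr_exact F I : Prop :=
  [/\ forall x : R, exists u : 'rV[R]_(fr_rank F 0),
        I (x - (u *m fr_aug F) 0 0),
      forall u : 'rV[R]_(fr_rank F 0),
        I ((u *m fr_aug F) 0 0) <-> exists v, u = v *m fr_diff F 0%N
    & forall i (u : 'rV[R]_(fr_rank F i.+1)),
        u *m fr_diff F i = 0 <-> exists v, u = v *m fr_diff F i.+1].

Definition graded_free_resolution F I : Prop :=
  fr_homogeneous F /\ fr_exact F I.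

(* The complex F (x)_R k, where k = R/(X_0, ..., X_(n-1)): the differentials
   become the matrices of constant terms. *)
Definition fr_diffk F i : 'M[k]_(fr_rank F i.+1, fr_rank F i) :=
  map_mx (fun p : R => p@_0%MM) (fr_diff F i).

(* The row space of this matrix is the degree j component of F_i (x) k. *)
Definition fr_comp F i (j : int) : 'M[k]_(fr_rank F i) :=
  diag_mx (\row_s (fr_deg s == j)%:R).

Definition fr_cycles F i (j : int) : 'M[k]_(fr_rank F i) :=
  match i with
  | 0%N => fr_comp F 0 j
  | i'.+1 => (fr_comp F i'.+1 j :&: kermx (fr_diffk F i'))%MS
  end.

Definition fr_boundaries F i (j : int) : 'M[k]_(fr_rank F i.+1, fr_rank F i) :=
  fr_comp F i.+1 j *m fr_diffk F i.

(* dim_k H_i(F (x) k)_j; for a homogeneous complex the boundaries are contained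
   in the cycles, so the truncated subtraction is the true one. *)
Definition fr_tor_dim F i (j : int) : nat :=
  (\rank (fr_cycles F i j) - \rank (fr_boundaries F i j))%N.

(* beta i j = dim_k Tor_i^R(R/I, k)_j for all i and j. Tor is computed from a
   graded free resolution of R/I, which is not required to be minimal; the
   dimensions do not depend on which one is used. *)
Definition graded_betti_numbers I (beta : nat -> int -> nat) : Prop :=
  exists2 F, graded_free_resolution F I
           & forall i j, beta i j = fr_tor_dim F i j.

End GradedBetti.

Section Example.
Variable k : fieldType.

Definition va : {mpoly k[3]} := 'X_(@Ordinal 3 0 isT).
Definition vb : {mpoly k[3]} := 'X_(@Ordinal 3 1 isT).
Definition vc : {mpoly k[3]} := 'X_(@Ordinal 3 2 isT).

Definition idealI : {mpoly k[3]} -> Prop :=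
  ideal_gen [:: va ^+ 3; vb ^+ 3; vc ^+ 3; vb * vc ^+ 2;
                va ^+ 2 * vb * vc; va ^+ 2 * vb ^+ 2].

Definition idealJ : {mpoly k[3]} -> Prop :=
  ideal_gen [:: va ^+ 3; vb ^+ 3; vc ^+ 3; vb * vc ^+ 2;
                va ^+ 2 * vc ^+ 2; va ^+ 2 * vb ^+ 2].

End Example.

Definition betti_table (i : nat) (j : int) : nat :=
  match i, j with
  | 0, Posz 0 => 1
  | 1, Posz 3 => 4
  | 1, Posz 4 => 2
  | 2, Posz 4 => 1
  | 2, Posz 5 => 6
  | 2, Posz 6 => 1
  | 3, Posz 6 => 1
  | 3, Posz 7 => 2
  | _, _ => 0
  end%N.

(* Main.v *)
Require Import Defs.
From HB Require Import structures.
From mathcomp Require Import all_boot all_order all_algebra.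
From mathcomp Require Import mpoly ring zify.
From Stdlib Require Import Classical ClassicalEpsilon.
From Stdlib Require Import Relation_Operators Operators_Properties.
From Stdlib Require Import FunctionalExtensionality PropExtensionality.

(* The ideal J is not licci because of a numerical invariant of linkage classes
   of cofinite ideals I in R = k[a,b,c].  Let C, generated by a regular sequence
   of length 3, be contained in I, and let w = (C : I)/C, a canonical module of
   R/I.  The invariant is dim_k (I (x)_R w) - 3 dim_k w, which is
   dim_k Hom(I, R/I) - 3 dim_k R/I.
   - It does not depend on C, since (C : D)/C = Tor_3(R/C, R/D) = (D : C)/D.
   - It is the same for I and I' = C : I.  The dual of I (x) I'/C consists of the
     balanced bilinear forms b on I x I' that vanish on I x C.  As C/C^2 is free,
     b(x, y) = l(xy) on C x I' for some functional l on C/C^2, and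
     (b, l) |-> (l(xy) - b(x, y), l) exchanges the roles of I and I'.
   - It is 0 for complete intersections, as C/C^2 = (R/C)^3.
   - It is 60 - 54 > 0 for J.
   The ideals in a linkage class need not be homogeneous; that regular sequences
   of length 3 generate cofinite ideals is obtained by counting monomials. *)

Set Implicit Arguments.
Unset Strict Implicit.
Unset Printing Implicit Defensive.

Import GRing.Theory.
Local Open Scope ring_scope.

(** * Koszul relations of regular sequences of length 3 *)

(** Both ideals have the same Betti table, so no criterion in terms of graded Betti numbers can show
    that J is not licci. The invariant used instead compares two dimensions: that of [Hom(I, R/I)],
    the tangent space at I to the Hilbert scheme of points of affine 3-space, and [3 dim R/I], the
    dimension of the family of [dim R/I] distinct points. Only the positivity of the invariant is
    carried along a chain of links. It is witnessed by finite families, a basis of w and more than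
    [3 dim w] independent balanced forms, so no tensor product or dual space is formed. After a
    link, the new forms are solutions of a linear system with more unknowns than equations. A
    further obstacle is that the complete intersection C of a link may a priori have fewer than
    three generators. Such a C satisfies [C : D = C] for every D generated by a regular sequence of
    length 3. If a proper J contains D and is linked by C, however, [C : J] is larger than C, since
    otherwise [J = C : C = R]. *)

Section IdealBasics.
Variable R : comNzRingType.
Implicit Types (I J C : R -> Prop) (s : seq R) (x y : R).

Lemma ideal0 I : is_ideal I -> I 0. Proof. by case. Qed.
Lemma idealD I x y : is_ideal I -> I x -> I y -> I (x + y).
Proof. by case=> _ + _; apply. Qed.
Lemma idealMl I r x : is_ideal I -> I x -> I (r * x).
Proof. by case=> _ _; apply. Qed.
Lemma idealMr I r x : is_ideal I -> I x -> I (x * r).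
Proof. by rewrite mulrC; apply: idealMl. Qed.
Lemma idealN I x : is_ideal I -> I x -> I (- x).
Proof. by rewrite -mulN1r; apply: idealMl. Qed.
Lemma idealB I x y : is_ideal I -> I x -> I y -> I (x - y).
Proof. by move=> iI Ix /(idealN iI); apply: idealD. Qed.
Lemma ideal_sum I n (P : pred 'I_n) (F : 'I_n -> R) :
  is_ideal I -> (forall i, P i -> I (F i)) -> I (\sum_(i | P i) F i).
Proof.
by move=> iI IF; apply: big_ind => //; [apply: ideal0|move=> x y; apply: idealD].
Qed.

Lemma ideal_gen_ideal s : is_ideal (ideal_gen s).
Proof.
split=> [|x y [r ->] [r' ->]|c x [r ->]].
- by exists (fun=> 0); rewrite big1 // => i _; rewrite mul0r.
- by exists (fun i => r i + r' i); rewrite -big_split; apply: eq_bigr => i _; rewrite mulrDl.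
- by exists (fun i => c * r i); rewrite mulr_sumr; apply: eq_bigr => i _; rewrite mulrA.
Qed.

Lemma colon_ideal C I : is_ideal C -> is_ideal (colon C I).
Proof.
move=> iC; split=> [y _|x y Cx Cy z Iz|r x Cx z Iz].
- by rewrite mul0r; apply: ideal0.
- by rewrite mulrDl; apply: idealD; [|apply: Cx|apply: Cy].
- by rewrite -mulrA; apply: idealMl; [|apply: Cx].
Qed.

Lemma ideal_gen_nth s (i : nat) : (i < size s)%N -> ideal_gen s s`_i.
Proof.
move=> lt_is; exists (fun j => (j == Ordinal lt_is)%:R).
rewrite (bigD1 (Ordinal lt_is)) //= eqxx mul1r big1 ?addr0 // => j /negPf ->.
by rewrite mul0r.
Qed.

Lemma ideal_gen_sub s I : is_ideal I -> (forall i, (i < size s)%N -> I s`_i) ->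
  sub_ideal (ideal_gen s) I.
Proof.
by move=> iI Is x [r ->]; apply: ideal_sum => // i _; apply: idealMl => //; apply: Is.
Qed.

Lemma ideal_gen_cons x s y :
  ideal_gen (x :: s) y <-> exists r, exists2 z, ideal_gen s z & y = r * x + z.
Proof.
split=> [[r ->]|[r [z [r' ->] ->]]].
  rewrite big_ord_recl /=; exists (r ord0); eexists; last by [].
  by exists (fun i => r (lift ord0 i)).
exists (fun i => if unlift ord0 i is Some j then r' j else r).
rewrite big_ord_recl unlift_none; congr (_ + _).
by apply: eq_bigr => i _; rewrite liftK.
Qed.

Lemma ideal_gen_nil x : ideal_gen [::] x <-> x = 0.
Proof. by split=> [[r ->]|->]; [rewrite big_ord0|apply: ideal0 (ideal_gen_ideal _)]. Qed.

Lemma ideal_gen1 f x : ideal_gen [:: f] x <-> exists r, x = r * f.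
Proof.
rewrite ideal_gen_cons; split=> [[r [z /ideal_gen_nil -> ->]]|[r ->]].
  by exists r; rewrite addr0.
by exists r, 0; rewrite ?addr0 //; apply/ideal_gen_nil.
Qed.

Lemma ideal_gen2 f1 f2 x :
  ideal_gen [:: f1; f2] x <-> exists r1 r2, x = r1 * f1 + r2 * f2.
Proof.
rewrite ideal_gen_cons; split=> [[r [z /ideal_gen1 [r' ->] ->]]|[r [r' ->]]].
  by exists r, r'.
by exists r, (r' * f2) => //; apply/ideal_gen1; exists r'.
Qed.

Lemma ideal_gen3 f1 f2 f3 x : ideal_gen [:: f1; f2; f3] x <->
  exists r1 r2 r3, x = r1 * f1 + r2 * f2 + r3 * f3.
Proof.
rewrite ideal_gen_cons; split=> [[r [z /ideal_gen2 [r' [r'' ->]] ->]]|[r [r' [r'' ->]]]].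
  by exists r, r', r''; rewrite addrA.
by exists r, (r' * f2 + r'' * f3); rewrite ?addrA //; apply/ideal_gen2; exists r', r''.
Qed.

End IdealBasics.

Lemma eq_from_sub (V : zmodType) (a b x y : V) : a = b -> x - y = a - b -> x = y.
Proof. by move=> -> /eqP; rewrite subrr subr_eq0 => /eqP. Qed.

(** Linear use of a hypothesis: the goal follows once the difference of its sides is that of [e], or
    of [e] reversed, so that both signs are covered. *)
Ltac ring_from e :=
  first [apply: (eq_from_sub e); ring | apply: (eq_from_sub (esym e)); ring].

Section Koszul.
Variable R : comNzRingType.
Implicit Types (x y z : R).

Definition weakly_regular2 f1 f2 := (forall x : R, f1 * x = 0 -> x = 0) /\
  (forall x y : R, f2 * x = f1 * y -> exists z, x = f1 * z).

Definition weakly_regular3 f1 f2 f3 := weakly_regular2 f1 f2 /\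
  (forall x y z : R, f3 * x = f1 * y + f2 * z -> exists u v, x = f1 * u + f2 * v).

Lemma regular1P f1 (s : seq R) : regular_sequence (f1 :: s) ->
  forall x : R, f1 * x = 0 -> x = 0.
Proof.
move=> [reg _] x fx0; have := reg 0%N isT x; rewrite /= fx0.
by move=> /(_ (ideal0 (ideal_gen_ideal _))) /ideal_gen_nil.
Qed.

Lemma regular2P f1 f2 (s : seq R) :
  regular_sequence [:: f1, f2 & s] -> weakly_regular2 f1 f2.
Proof.
move=> reg; split=> [|x y e]; first exact: regular1P reg.
have /= := reg.1 1%N isT x; rewrite ?take0 e => H.
have /H/ideal_gen1 [z ->] : ideal_gen [:: f1] (f1 * y).
  by apply/ideal_gen1; exists y; rewrite mulrC.
by exists z; rewrite mulrC.
Qed.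

Lemma regular3P f1 f2 f3 (s : seq R) :
  regular_sequence [:: f1, f2, f3 & s] -> weakly_regular3 f1 f2 f3.
Proof.
move=> reg; split=> [|x y z e]; first exact: regular2P reg.
have /= := reg.1 2%N isT x; rewrite ?take0 e => H.
have /H/ideal_gen2 [u [v ->]] : ideal_gen [:: f1; f2] (f1 * y + f2 * z).
  by apply/ideal_gen2; exists y, z; rewrite mulrC [z * _]mulrC.
by exists u, v; rewrite mulrC [f2 * _]mulrC.
Qed.

Lemma weakly_regular3_regular f1 f2 f3 : weakly_regular3 f1 f2 f3 ->
  ~ ideal_gen [:: f1; f2; f3] 1 -> regular_sequence [:: f1; f2; f3].
Proof.
move=> [[r1 r2] r3] prop; split=> // -[|[|[|i]]] //= _ x.
- by move/ideal_gen_nil/r1 => ->; apply/ideal_gen_nil.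
- move/ideal_gen1 => [y]; rewrite [y * _]mulrC => /r2 [z ->].
  by apply/ideal_gen1; exists z; rewrite mulrC.
- move/ideal_gen2 => [y [z]]; rewrite [y * _]mulrC [z * _]mulrC => /r3 [u [v ->]].
  by apply/ideal_gen2; exists u, v; rewrite mulrC [f2 * _]mulrC.
Qed.

Lemma koszul2_exact f1 f2 : weakly_regular2 f1 f2 ->
  forall a1 a2, f1 * a1 + f2 * a2 = 0 -> exists b, a1 = - (f2 * b) /\ a2 = f1 * b.
Proof.
move=> [r1 r2] a1 a2 e.
have [b eb] : exists b, a2 = f1 * b by apply: (r2 _ (- a1)); ring_from e.
exists b; split=> //; apply/eqP; rewrite -subr_eq0; apply/eqP/r1.
by rewrite -[RHS]e eb; ring.
Qed.

Local Notation V := (R * R * R)%type.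
Implicit Types f g a b : V.

(** With the two middle terms of the Koszul complex K(f) identified with triples, its differentials
    are [y |-> scalev y f], [cross f] and [dot f]. *)
Definition dot a b := a.1.1 * b.1.1 + a.1.2 * b.1.2 + a.2 * b.2.
Definition cross a b : V :=
  (a.1.2 * b.2 - a.2 * b.1.2, a.2 * b.1.1 - a.1.1 * b.2,
   a.1.1 * b.1.2 - a.1.2 * b.1.1).
Definition scalev x a : V := (x * a.1.1, x * a.1.2, x * a.2).

Definition regular_vec f := weakly_regular3 f.1.1 f.1.2 f.2.

(** By regularity the last coordinate lies in [(f1, f2)]. Subtracting the Koszul relations that
    account for it leaves a relation between [f1] and [f2] alone. *)
Lemma koszul3_exact f a : regular_vec f -> dot f a = 0 -> exists b, a = cross f b.
Proof.
move: f a => [[f1 f2] f3] [[a1 a2] a3] [[/= r1 r2] r3]; rewrite /dot /= => e.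
have [u [v e3]] : exists u v, a3 = f1 * u + f2 * v.
  by apply: (r3 _ (- a1) (- a2)); ring_from e.
have e' : f1 * (a1 + f3 * u) + f2 * (a2 + f3 * v) = 0 by rewrite -[RHS]e e3; ring.
have [z [ez1 ez2]] := koszul2_exact (conj r1 r2) e'.
exists (- v, u, - z); congr (_, _, _) => /=; [ring_from ez1|ring_from ez2|ring_from e3].
Qed.

Lemma cross_eq0 f b : regular_vec f -> cross f b = 0 -> exists y, b = scalev y f.
Proof.
move: f b => [[f1 f2] f3] [[b1 b2] b3] [[/= r1 r2] _] [/eqP + /eqP + /eqP +].
rewrite !subr_eq0 /= => _ /eqP e2 /eqP e3.
have [y e1] := r2 _ _ (esym e3).
exists y; rewrite /scalev /= e1; congr (_, _, _); first by ring.
  by apply/eqP; rewrite -subr_eq0; apply/eqP/r1; rewrite mulrBr e3 e1; ring.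
by apply/eqP; rewrite -subr_eq0; apply/eqP/r1; rewrite mulrBr -e2 e1; ring.
Qed.

Definition vec_ideal f := ideal_gen [:: f.1.1; f.1.2; f.2].

Lemma vec_idealP f x : vec_ideal f x <-> exists a, x = dot f a.
Proof.
rewrite /vec_ideal ideal_gen3; split=> [[r1 [r2 [r3 ->]]]|[[[r1 r2] r3] ->]].
  by exists (r1, r2, r3); rewrite /dot /=; ring.
by exists r1, r2, r3; rewrite /dot /=; ring.
Qed.

(* A zigzag in the double complex K(f) (x) K(g), from the bidegree (0, 3) with
   value x to the bidegree (3, 0) with value y.  It induces the isomorphism
   ((f) : (g))/(f) = Tor_3(R/(f), R/(g)) = ((g) : (f))/(g). *)
Definition zigzag f g x y := exists A1 A2 A3 B1 B2 B3 : V,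
  [/\ [/\ x * g.1.1 = dot f A1, x * g.1.2 = dot f A2 & x * g.2 = dot f A3],
      [/\ scalev g.1.2 A3 - scalev g.2 A2 = cross f B1,
          scalev g.2 A1 - scalev g.1.1 A3 = cross f B2 &
          scalev g.1.1 A2 - scalev g.1.2 A1 = cross f B3] &
      scalev y f = scalev g.1.1 B1 + scalev g.1.2 B2 + scalev g.2 B3].

Lemma vecP a b : a.1.1 = b.1.1 -> a.1.2 = b.1.2 -> a.2 = b.2 -> a = b.
Proof. by move: a b => [[a1 a2] a3] [[b1 b2] b3] /= -> -> ->. Qed.

Lemma vec_eq a b : a = b -> [/\ a.1.1 = b.1.1, a.1.2 = b.1.2 & a.2 = b.2].
Proof. by move=> ->. Qed.

(** The zigzag is read backwards: regrouped by coordinate, the entries of the [B]s become the new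
    [A]s, and those of the [A]s the new [B]s. *)
Lemma zigzag_sym f g x y : zigzag f g x y -> zigzag g f y x.
Proof.
move=> [A1 [A2 [A3 [B1 [B2 [B3 [[eA1 eA2 eA3]]]]]]]].
case=> /vec_eq/=[e11 e12 e13] /vec_eq/=[e21 e22 e23] /vec_eq/=[e31 e32 e33].
move=> /vec_eq/= [ey1 ey2 ey3].
exists (B1.1.1, B2.1.1, B3.1.1), (B1.1.2, B2.1.2, B3.1.2), (B1.2, B2.2, B3.2).
exists (A1.1.1, A2.1.1, A3.1.1), (A1.1.2, A2.1.2, A3.1.2), (A1.2, A2.2, A3.2).
rewrite /dot /=; split; first by split; [ring_from ey1|ring_from ey2|ring_from ey3].
  by split; apply: vecP => /=; [ring_from e11|ring_from e21|ring_from e31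
    |ring_from e12|ring_from e22|ring_from e32|ring_from e13|ring_from e23|ring_from e33].
rewrite /dot in eA1 eA2 eA3; apply: vecP => /=; [ring_from eA1|ring_from eA2|ring_from eA3].
Qed.

Lemma zigzag_linear f g r x y x' y' :
  zigzag f g x y -> zigzag f g x' y' -> zigzag f g (r * x + x') (r * y + y').
Proof.
move=> [A1 [A2 [A3 [B1 [B2 [B3 [[eA1 eA2 eA3] [e1 e2 e3] ey]]]]]]].
move=> [A1' [A2' [A3' [B1' [B2' [B3' [[eA1' eA2' eA3'] [e1' e2' e3'] ey']]]]]]].
have lin a a' b : dot b (scalev r a + a') = r * dot b a + dot b a'.
  by rewrite /dot /=; ring.
have linc a a' b : cross b (scalev r a + a') = scalev r (cross b a) + cross b a'.
  by apply: vecP => /=; ring.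
exists (scalev r A1 + A1'), (scalev r A2 + A2'), (scalev r A3 + A3').
exists (scalev r B1 + B1'), (scalev r B2 + B2'), (scalev r B3 + B3').
rewrite !lin !linc -eA1 -eA2 -eA3 -eA1' -eA2' -eA3' -e1 -e2 -e3 -e1' -e2' -e3'.
split; [by split; ring|by split; apply: vecP => /=; ring|].
have -> : scalev (r * y + y') f = scalev r (scalev y f) + scalev y' f.
  by apply: vecP => /=; ring.
by rewrite ey ey'; apply: vecP => /=; ring.
Qed.

(** Each stage is lifted by exactness of K(f): the mixed differences of the [A]s are cycles, hence
    of the form [cross f B], and the combination of the [B]s is a cycle, hence a multiple of [f]. *)
Lemma zigzag_exists f g x : regular_vec f ->
  vec_ideal f (x * g.1.1) -> vec_ideal f (x * g.1.2) -> vec_ideal f (x * g.2) ->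
  exists y, zigzag f g x y.
Proof.
move=> reg /vec_idealP [A1 e1] /vec_idealP [A2 e2] /vec_idealP [A3 e3].
have syz r s a b : x * r = dot f a -> x * s = dot f b ->
    exists B, scalev r b - scalev s a = cross f B.
  move=> ea eb; apply: koszul3_exact => //.
  have -> : dot f (scalev r b - scalev s a) = r * dot f b - s * dot f a.
    by rewrite /dot /=; ring.
  by rewrite -ea -eb; ring.
have [B1 eB1] := syz _ _ _ _ e2 e3.
have [B2 eB2] := syz _ _ _ _ e3 e1.
have [B3 eB3] := syz _ _ _ _ e1 e2.
have [y ey] : exists y, scalev g.1.1 B1 + scalev g.1.2 B2 + scalev g.2 B3 = scalev y f.
  apply: cross_eq0 => //.
  have -> : cross f (scalev g.1.1 B1 + scalev g.1.2 B2 + scalev g.2 B3) =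
     scalev g.1.1 (cross f B1) + scalev g.1.2 (cross f B2) + scalev g.2 (cross f B3).
    by apply: vecP => /=; ring.
  by rewrite -eB1 -eB2 -eB3; apply: vecP => /=; ring.
by exists y, A1, A2, A3, B1, B2, B3.
Qed.

(** If [x = dot f u], each [A_i] is [g_i u] up to a boundary [cross f v_i], so each [B_i] is the
    induced combination of the [v]s up to a multiple [w_i f]. The [v]s cancel in the last equation,
    leaving [y = dot g w]. *)
Lemma zigzag_mem f g x y : regular_vec f -> zigzag f g x y ->
  vec_ideal f x -> vec_ideal g y.
Proof.
move=> reg [A1 [A2 [A3 [B1 [B2 [B3 [[eA1 eA2 eA3] [e1 e2 e3] ey]]]]]]].
move=> /vec_idealP [u eu].
have lift a r : x * r = dot f a -> exists v, a = scalev r u + cross f v.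
  move=> ea; have [v ev] : exists v, a - scalev r u = cross f v.
    apply: koszul3_exact => //.
    have -> : dot f (a - scalev r u) = dot f a - r * dot f u by rewrite /dot /=; ring.
    by rewrite -ea -eu; ring.
  by exists v; rewrite -ev addrC subrK.
have [v1 ev1] := lift _ _ eA1; have [v2 ev2] := lift _ _ eA2.
have [v3 ev3] := lift _ _ eA3.
have rest B b : cross f b = cross f B -> exists w, B = b + scalev w f.
  move=> eB; have [w ew] : exists w, B - b = scalev w f.
    apply: cross_eq0 => //.
    have -> : cross f (B - b) = cross f B - cross f b by apply: vecP => /=; ring.
    by rewrite eB subrr.
  by exists w; rewrite -ew addrC subrK.
have [w1 ew1] : exists w, B1 = scalev g.1.2 v3 - scalev g.2 v2 + scalev w f.
  by apply: rest; rewrite -e1 ev2 ev3; apply: vecP => /=; ring.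
have [w2 ew2] : exists w, B2 = scalev g.2 v1 - scalev g.1.1 v3 + scalev w f.
  by apply: rest; rewrite -e2 ev1 ev3; apply: vecP => /=; ring.
have [w3 ew3] : exists w, B3 = scalev g.1.1 v2 - scalev g.1.2 v1 + scalev w f.
  by apply: rest; rewrite -e3 ev1 ev2; apply: vecP => /=; ring.
apply/vec_idealP; exists (w1, w2, w3); apply/eqP; rewrite -subr_eq0; apply/eqP.
have [[reg1 _] _] := reg; apply: reg1; have /vec_eq [+ _ _] := ey.
by rewrite ew1 ew2 ew3 /dot /= => e; ring_from e.
Qed.

(** The ideal [(g)] has grade 3, so its elements cannot all kill a nonzero class modulo a shorter
    regular sequence. Here the quotients [a] satisfy [cross g a = 0] after cancelling [f1], hence
    are a multiple of [g]. *)
Lemma colon_regular1 (f1 : R) g x : (forall z, f1 * z = 0 -> z = 0) -> regular_vec g ->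
  ideal_gen [:: f1] (x * g.1.1) -> ideal_gen [:: f1] (x * g.1.2) ->
  ideal_gen [:: f1] (x * g.2) -> ideal_gen [:: f1] x.
Proof.
move=> reg regg /ideal_gen1 [a1 e1] /ideal_gen1 [a2 e2] /ideal_gen1 [a3 e3].
have cancel u v : f1 * u = f1 * v -> u = v.
  by move=> e; apply/eqP; rewrite -subr_eq0; apply/eqP/reg; rewrite mulrBr e subrr.
have [u eu] : exists u, (a1, a2, a3) = scalev u g.
  apply: cross_eq0 => //; apply: vecP => /=; apply: reg.
  - have -> : f1 * (g.1.2 * a3 - g.2 * a2) = g.1.2 * (a3 * f1) - g.2 * (a2 * f1) by ring.
    by rewrite -e2 -e3; ring.
  - have -> : f1 * (g.2 * a1 - g.1.1 * a3) = g.2 * (a1 * f1) - g.1.1 * (a3 * f1) by ring.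
    by rewrite -e1 -e3; ring.
  - have -> : f1 * (g.1.1 * a2 - g.1.2 * a1) = g.1.1 * (a2 * f1) - g.1.2 * (a1 * f1) by ring.
    by rewrite -e1 -e2; ring.
have [ea1 _ _] := vec_eq eu; rewrite /= in ea1.
apply/ideal_gen1; exists u; apply/eqP; rewrite -subr_eq0; apply/eqP.
have [[regg1 _] _] := regg; apply: regg1.
by rewrite ea1 in e1; ring_from e1.
Qed.

(** The quotients now satisfy [cross g a = - f2 c] and [cross g b = f1 c]. The defect [c] is itself
    a cycle of K(g), so [c = cross g w], and [w] corrects [a] and [b] into multiples of [g]. *)
Lemma colon_regular2 (f1 f2 : R) g x : weakly_regular2 f1 f2 -> regular_vec g ->
  ideal_gen [:: f1; f2] (x * g.1.1) -> ideal_gen [:: f1; f2] (x * g.1.2) ->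
  ideal_gen [:: f1; f2] (x * g.2) -> ideal_gen [:: f1; f2] x.
Proof.
move=> reg regg /ideal_gen2 [a1 [b1 e1]] /ideal_gen2 [a2 [b2 e2]].
move=> /ideal_gen2 [a3 [b3 e3]].
have syz (r s a b a' b' : R) : x * r = a * f1 + b * f2 -> x * s = a' * f1 + b' * f2 ->
    exists c, r * a' - s * a = - (f2 * c) /\ r * b' - s * b = f1 * c.
  move=> ea eb; apply: koszul2_exact => //.
  have -> : f1 * (r * a' - s * a) + f2 * (r * b' - s * b) =
     r * (a' * f1 + b' * f2) - s * (a * f1 + b * f2) by ring.
  by rewrite -ea -eb; ring.
have [c1 [ea1 eb1]] := syz _ _ _ _ _ _ e2 e3.
have [c2 [ea2 eb2]] := syz _ _ _ _ _ _ e3 e1.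
have [c3 [ea3 eb3]] := syz _ _ _ _ _ _ e1 e2.
have [w ew] : exists w, (c1, c2, c3) = cross g w.
  apply: koszul3_exact => //; apply: reg.1.
  have -> : f1 * dot g (c1, c2, c3) = g.1.1 * (f1 * c1) + g.1.2 * (f1 * c2) + g.2 * (f1 * c3).
    by rewrite /dot /=; ring.
  by rewrite -eb1 -eb2 -eb3; ring.
have [/= ec1 ec2 ec3] := vec_eq ew.
have [u eu] : exists u, (a1 + f2 * w.1.1, a2 + f2 * w.1.2, a3 + f2 * w.2) = scalev u g.
  apply: cross_eq0 => //; apply: vecP => /=.
  - by rewrite ec1 in ea1; ring_from ea1.
  - by rewrite ec2 in ea2; ring_from ea2.
  - by rewrite ec3 in ea3; ring_from ea3.
have [v ev] : exists v, (b1 - f1 * w.1.1, b2 - f1 * w.1.2, b3 - f1 * w.2) = scalev v g.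
  apply: cross_eq0 => //; apply: vecP => /=.
  - by rewrite ec1 in eb1; ring_from eb1.
  - by rewrite ec2 in eb2; ring_from eb2.
  - by rewrite ec3 in eb3; ring_from eb3.
have [/= eu1 _ _] := vec_eq eu; have [/= ev1 _ _] := vec_eq ev.
apply/ideal_gen2; exists u, v; apply/eqP; rewrite -subr_eq0; apply/eqP.
have [[regg1 _] _] := regg; apply: regg1.
have -> : g.1.1 * (x - (u * f1 + v * f2)) = x * g.1.1 - (u * g.1.1) * f1 - (v * g.1.1) * f2 by ring.
by rewrite -eu1 -ev1 e1; ring.
Qed.

End Koszul.

(** * Linear independence modulo a subspace *)

Section IndependenceModulo.
Variables (k : fieldType) (V : lmodType k).
Implicit Types (U W : V -> Prop).

Definition subspace W := W 0 /\ forall (c : k) x y, W x -> W y -> W (c *: x + y).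

Lemma subspace_sum W n (c : 'I_n -> k) (e : 'I_n -> V) :
  subspace W -> (forall i, W (e i)) -> W (\sum_i c i *: e i).
Proof.
move=> [W0 WD] We; elim/big_rec: _ => // i x _ Wx; exact: WD.
Qed.

Lemma subspaceB W x y : subspace W -> W x -> W y -> W (x - y).
Proof.
by move=> [W0 WD] Wx Wy; rewrite addrC -scaleN1r; apply: WD.
Qed.

(** Quotients are never formed: the dimension of [U/W] is the length of a family with
    [basis_mod U W]. *)
Definition indep_mod W n (e : 'I_n -> V) :=
  forall c : 'I_n -> k, W (\sum_i c i *: e i) -> forall i, c i = 0.

Definition basis_mod U W n (e : 'I_n -> V) :=
  [/\ forall i, U (e i), indep_mod W e &
      forall u, U u -> exists c, W (u - \sum_i c i *: e i)].

Definition finite_codim W :=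
  exists B, forall n (e : 'I_n -> V), indep_mod W e -> (n <= B)%N.

Lemma left_kernel_nontrivial m n (A : 'M[k]_(m, n)) : (n < m)%N ->
  exists2 u : 'rV_m, u *m A = 0 & u != 0.
Proof.
move=> ltnm; have /rowV0Pn [u uK nzu] : kermx A != 0.
  rewrite -mxrank_eq0 mxrank_ker -lt0n subn_gt0.
  exact: leq_ltn_trans (rank_leq_col A) ltnm.
by exists u => //; apply/sub_kermxP.
Qed.

Lemma indep_mod_le U W m n (e : 'I_m -> V) (f : 'I_n -> V) : subspace W ->
  basis_mod U W e -> (forall i, U (f i)) -> indep_mod W f -> (n <= m)%N.
Proof.
move=> sW [_ _ spane] Uf indf; case: leqP => // ltmn; exfalso.
have [A eA] := fin_all_exists (fun j => spane _ (Uf j)).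
have [u uA nzu] := left_kernel_nontrivial (\matrix_(j, i) A j i) ltmn.
case/eqP: nzu; apply/rowP=> j; rewrite mxE; apply: (indf (u 0)).
have -> : \sum_i u 0 i *: f i = \sum_i u 0 i *: (f i - \sum_j A i j *: e j).
  have -> : \sum_i u 0 i *: (f i - \sum_j A i j *: e j) =
      \sum_i u 0 i *: f i - \sum_i u 0 i *: \sum_j A i j *: e j.
    by rewrite -sumrB; apply: eq_bigr => i _; rewrite scalerBr.
  rewrite [X in _ - X](_ : _ = 0) ?subr0 //.
  under eq_bigr do rewrite scaler_sumr.
  rewrite exchange_big big1 //= => l _.
  have /matrixP/(_ 0 l) := uA; rewrite !mxE => e0.
  rewrite -[RHS](scale0r (e l)) -[in RHS]e0 scaler_suml.
  by apply: eq_bigr => i _; rewrite mxE scalerA.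
by apply: subspace_sum.
Qed.

Definition family_cat m n (e : 'I_m -> V) (f : 'I_n -> V) (i : 'I_(m + n)) :=
  match split i with inl j => e j | inr j => f j end.

Lemma family_catE m n (e : 'I_m -> V) (f : 'I_n -> V) c :
  \sum_i c i *: family_cat e f i =
  \sum_i c (lshift n i) *: e i + \sum_i c (rshift m i) *: f i.
Proof.
rewrite big_split_ord /family_cat; congr (_ + _); apply: eq_bigr => i _.
  by rewrite -[lshift n i]/(unsplit (inl i)) unsplitK.
by rewrite -[rshift m i]/(unsplit (inr i)) unsplitK.
Qed.

Lemma basis_mod_exists U W : subspace W -> finite_codim W ->
  exists n (e : 'I_n -> V), basis_mod U W e.
Proof.
move=> sW [B bB]; apply: NNPP => nob.
have step n : exists e : 'I_n -> V, (forall i, U (e i)) /\ indep_mod W e.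
  elim: n => [|n [e [Ue inde]]]; first by exists (fun=> 0); split=> [[]|? ? []].
  have [u [Uu nu]] : exists u, U u /\ ~ exists c, W (u - \sum_i c i *: e i).
    apply: NNPP => none; apply: nob; exists n, e; split=> // u Uu.
    by apply: NNPP => nu; apply: none; exists u.
  rewrite -addn1; exists (family_cat e (fun _ : 'I_1 => u)); split.
    by move=> i; rewrite /family_cat; case: split.
  move=> c; rewrite family_catE big_ord1 => Wc.
  have cu0 : c (rshift n ord0) = 0.
    apply/eqP; apply: contra_notT nu => nz.
    exists (fun i => - (c (rshift n ord0))^-1 * c (lshift 1 i)).
    have := (sW.2 (c (rshift n ord0))^-1 _ _ Wc sW.1); rewrite addr0 scalerDr.
    rewrite scalerA mulVf // scale1r scaler_sumr addrC; congr (W (_ + _)).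
    rewrite -sumrN; apply: eq_bigr => i _.
    by rewrite scalerA mulNr scaleNr opprK.
  move: Wc; rewrite cu0 scale0r addr0 => /inde cl i.
  rewrite -(splitK i); case: (split i) => j /=; first exact: cl.
  by rewrite ord1.
have [e [_ /bB]] := step B.+1; by rewrite ltnn.
Qed.

(** Additivity of dimension along the chain [W], [U], [X]. *)
Lemma basis_mod_cat X U W m n (e : 'I_m -> V) (f : 'I_n -> V) :
  subspace X -> subspace U -> subspace W ->
  (forall x, W x -> U x) -> (forall x, U x -> X x) ->
  basis_mod X U e -> basis_mod U W f -> basis_mod X W (family_cat e f).
Proof.
move=> sX sU sW WU UX [Xe inde spane] [Uf indf spanf]; split.
- by move=> i; rewrite /family_cat; case: split => j; [apply: Xe|apply/UX/Uf].
- move=> c; rewrite family_catE => Wc.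
  have cl i : c (lshift n i) = 0.
    apply: (inde (fun i => c (lshift n i))).
    have := subspaceB sU (WU _ Wc) (subspace_sum (fun i => c (rshift m i)) sU Uf).
    by rewrite addrK.
  have cr i : c (rshift m i) = 0.
    apply: (indf (fun i => c (rshift m i))); move: Wc.
    by rewrite [X in X + _]big1 ?add0r // => j _; rewrite cl scale0r.
  by move=> i; rewrite -(splitK i); case: (split i) => j; [apply: cl|apply: cr].
- move=> u /spane [c /spanf [d Wd]].
  exists (fun i => match split i with inl j => c j | inr j => d j end).
  rewrite family_catE opprD addrA; move: Wd; congr (W (_ - _ - _)); apply: eq_bigr => i _.
    by rewrite -[lshift n i]/(unsplit (inl i)) unsplitK.
  by rewrite -[rshift m i]/(unsplit (inr i)) unsplitK.
Qed.

(** [Z] is the graph of an isomorphism of [U/W] with [U'/W']. A relation is used because zigzags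
    determine their end only modulo an ideal. *)
Lemma basis_mod_transfer (Z : V -> V -> Prop) U W U' W' n (e : 'I_n -> V) :
  (forall (c : k) x y x' y', Z x y -> Z x' y' -> Z (c *: x + x') (c *: y + y')) ->
  Z 0 0 ->
  (forall x, U x -> exists2 y, U' y & Z x y) ->
  (forall y, U' y -> exists2 x, U x & Z x y) ->
  (forall x y, Z x y -> W x <-> W' y) ->
  basis_mod U W e -> exists e' : 'I_n -> V, basis_mod U' W' e'.
Proof.
move=> Zlin Z0 ZU ZU' ZW [Ue inde spane].
have [e' He'] : exists e' : 'I_n -> V, forall i, U' (e' i) /\ Z (e i) (e' i).
  apply: (@fin_all_exists _ (fun=> V) (fun i y => U' y /\ Z (e i) y)) => i.
  by have [y] := ZU _ (Ue i); exists y.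
have Zsum c : Z (\sum_i c i *: e i) (\sum_i c i *: e' i).
  by elim/big_rec2: _ => // i x y _; apply: Zlin; case: (He' i).
exists e'; split=> [i|c|y U'y]; first by case: (He' i).
  by move/ZW: (Zsum c) => [_ /[apply]]; apply: inde.
have [x /spane [c Wc] Zxy] := ZU' _ U'y; exists c.
have ZB : Z (x - \sum_i c i *: e i) (y - \sum_i c i *: e' i).
  by rewrite addrC -scaleN1r [y - _]addrC -[in X in Z _ X]scaleN1r; apply: Zlin.
by apply/(ZW _ _ ZB).
Qed.

End IndependenceModulo.

(** * The invariant and its independence of the complete intersection *)

Section Excess.
Variables (k : fieldType) (R : comAlgType k).
Implicit Types (I J C M : R -> Prop) (f g : R * R * R) (x y z : R).

Lemma ideal_subspace I : is_ideal I -> subspace I.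
Proof.
move=> iI; split; first exact: ideal0.
move=> c x y Ix Iy; apply: idealD => //.
by rewrite -mulr_algl; apply: idealMl.
Qed.

Definition linear_on M (l : R -> k) :=
  forall (c : k) x y, M x -> M y -> l (c *: x + y) = c * l x + l y.

Definition balanced_form J M C (b : R -> R -> k) :=
  [/\ forall y, M y -> linear_on J (b^~ y),
      forall x, J x -> linear_on M (b x),
      forall r x y, J x -> M y -> b (r * x) y = b x (r * y) &
      forall x y, J x -> C y -> b x y = 0].

Definition free_forms J M n (F : 'I_n -> R -> R -> k) :=
  forall c : 'I_n -> k, (forall x y, J x -> M y -> \sum_i c i * F i x y = 0) ->
  forall i, c i = 0.

(* A linkage invariant.  With w = (C : J)/C, the balanced forms are the dual of
   the tensor product of J and w, and the condition is
   dim (J (x) w) > 3 dim w. *)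
Definition excess J C := exists w n (e : 'I_w -> R) (F : 'I_n -> R -> R -> k),
  [/\ basis_mod (colon C J) C e, (3 * w < n)%N,
      forall i, balanced_form J (colon C J) C (F i) & free_forms J (colon C J) F].

Lemma linear_on0 M l : is_ideal M -> linear_on M l -> l 0 = 0.
Proof.
move=> iM lin; have := lin (-1) 0 0 (ideal0 iM) (ideal0 iM).
by rewrite scaler0 addr0 mulN1r addNr.
Qed.

Lemma linear_onB M l x y : is_ideal M -> linear_on M l -> M x -> M y ->
  l (x - y) = l x - l y.
Proof.
move=> iM lin Mx My.
by rewrite addrC -scaleN1r lin // mulN1r addrC.
Qed.

Lemma linear_onD M l x y : linear_on M l -> M x -> M y -> l (x + y) = l x + l y.
Proof. by move=> lin Mx My; rewrite -[x]scale1r lin // mul1r scale1r. Qed.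

Lemma linear_on_sum M l n (c : 'I_n -> k) (e : 'I_n -> R) :
  is_ideal M -> linear_on M l -> (forall i, M (e i)) ->
  l (\sum_i c i *: e i) = \sum_i c i * l (e i).
Proof.
move=> iM lin Me.
have [] // : l (\sum_i c i *: e i) = \sum_i c i * l (e i) /\ M (\sum_i c i *: e i).
elim/big_rec2: _ => [|i y z _ [<- Mz]]; first by split; [apply: linear_on0 lin|apply: ideal0].
by rewrite lin //; split=> //; apply: (ideal_subspace iM).2.
Qed.

Lemma vec_ideal_ideal f : is_ideal (vec_ideal f).
Proof. exact: ideal_gen_ideal. Qed.

Lemma vec_ideal_gens f : [/\ vec_ideal f f.1.1, vec_ideal f f.1.2 & vec_ideal f f.2].
Proof.
by split; [apply: (@ideal_gen_nth _ _ 0)|apply: (@ideal_gen_nth _ _ 1)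
  |apply: (@ideal_gen_nth _ _ 2)].
Qed.

(** Zigzags give an isomorphism of [(C : J)/C] with [(D : J)/D] that is linear over the ring, and
    balanced forms are transported along it. *)
Lemma excess_exchange f g J : is_ideal J -> regular_vec f -> regular_vec g ->
  sub_ideal (vec_ideal f) J -> sub_ideal (vec_ideal g) J ->
  excess J (vec_ideal f) -> excess J (vec_ideal g).
Proof.
move=> iJ regf regg sfJ sgJ [w [n [e [F [be ltwn balF freeF]]]]].
set C := vec_ideal f in sfJ be balF freeF; set D := vec_ideal g in sgJ *.
have iC : is_ideal C := vec_ideal_ideal f; have iD : is_ideal D := vec_ideal_ideal g.
have iCJ := colon_ideal J iC; have iDJ := colon_ideal J iD.
have [f1 f2 f3] := vec_ideal_gens f; have [g1 g2 g3] := vec_ideal_gens g.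
pose Z := zigzag f g.
have ZW x y : Z x y -> C x <-> D y.
  by move=> Zxy; split; apply: zigzag_mem => //; apply: zigzag_sym.
have ZM r x y : Z x y -> Z (r * x) (r * y).
  (* The coefficient is [r - 1] because [zigzag_linear] adds one further copy of the zigzag. *)
  move=> Zxy; have := zigzag_linear (r - 1) Zxy Zxy.
  by rewrite !mulrBl !mul1r !subrK.
have Z0 : Z 0 0.
  have [[y Zy] _] : (exists y, Z 0 y) /\ True.
    by split=> //; apply: zigzag_exists => //; rewrite mul0r; apply: ideal0.
  by have := ZM 0 _ _ Zy; rewrite !mul0r.
have Zlin (c : k) x y x' y' : Z x y -> Z x' y' -> Z (c *: x + x') (c *: y + y').
  by rewrite -[c *: x]mulr_algl -[c *: y]mulr_algl; apply: zigzag_linear.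
have ZB x y x' y' : Z x y -> Z x' y' -> Z (x - x') (y - y').
  move=> Zxy Zxy'; have := Zlin (-1) _ _ _ _ Zxy' Zxy.
  by rewrite !scaleN1r addrC [- _ + _]addrC.
have Zcolon x y : Z x y -> colon C J x <-> colon D J y.
  move=> Zxy; split=> H j Jj.
    by rewrite mulrC; apply/(ZW _ _ (ZM j _ _ Zxy)); rewrite mulrC; apply: H.
  by rewrite mulrC; apply/(ZW _ _ (ZM j _ _ Zxy)); rewrite mulrC; apply: H.
have ZU x : colon C J x -> exists2 y, colon D J y & Z x y.
  move=> CJx; have [y Zxy] : exists y, Z x y.
    by apply: zigzag_exists => //; apply: CJx; apply: sgJ.
  by exists y => //; apply/(Zcolon _ _ Zxy).
have ZU' y : colon D J y -> exists2 x, colon C J x & Z x y.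
  move=> DJy; have [x Zyx] : exists x, zigzag g f y x.
    by apply: zigzag_exists => //; apply: DJy; apply: sfJ.
  have Zxy : Z x y := zigzag_sym Zyx; by exists x => //; apply/(Zcolon _ _ Zxy).
have [e' be'] := basis_mod_transfer Zlin Z0 ZU ZU' ZW be.
(* A chosen preimage of [y]. Two choices differ by an element of [C], on which the forms vanish, so
   the transported forms are linear and balanced although [z] is not linear. *)
pose z y := epsilon (inhabits 0) (fun x => Z x y).
have Zz y : colon D J y -> Z (z y) y.
  by move=> /ZU' [x _ Zxy]; exact: (epsilon_spec (inhabits 0) (fun x => Z x y) (ex_intro _ x Zxy)).
have colz y : colon D J y -> colon C J (z y).
  by move=> DJy; apply/(Zcolon _ _ (Zz _ DJy)).
have Fmod i x u v : J x -> colon C J u -> colon C J v -> C (u - v) -> F i x u = F i x v.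
  move=> Jx cu cv Cuv; apply/eqP; rewrite -subr_eq0.
  have [_ lin _ F0] := balF i.
  by rewrite -(linear_onB iCJ (lin x Jx)) // F0.
exists w, n, e', (fun i x y => F i x (z y)); split=> // [i|c cF].
  have [lin1 lin2 bal F0] := balF i; split.
  - by move=> y DJy; apply: lin1; apply: colz.
  - move=> x Jx c y y' cy cy'.
    have cyy' : colon D J (c *: y + y') by apply: (ideal_subspace iDJ).2.
    rewrite -(lin2 x Jx) ?colz //; try exact: colz.
    apply: Fmod => //; [exact: colz|by apply: (ideal_subspace iCJ).2; apply: colz|].
    apply/(ZW _ (c *: y + y' - (c *: y + y'))); last by rewrite subrr; apply: ideal0.
    by apply: ZB; [apply: Zz|apply: Zlin; apply: Zz].
  - move=> r x y Jx cy; rewrite bal //; last exact: colz.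
    have cry : colon D J (r * y) by exact: (idealMl r iDJ cy).
    apply: Fmod => //; [exact: (idealMl r iCJ (colz _ cy))|exact: colz|].
    apply/(ZW _ (r * y - r * y)); last by rewrite subrr; apply: ideal0.
    by apply: ZB; [apply: ZM; apply: Zz|apply: Zz].
  - move=> x y Jx Dy; apply: F0 => //; apply/(ZW _ y) => //; apply: Zz.
    by move=> j Jj; apply: idealMr.
apply: freeF => x y Jx cy; have [y' cy' Zyy'] := ZU _ cy.
rewrite -[RHS](cF x y' Jx cy'); apply: eq_bigr => i _; congr (_ * _).
apply: Fmod => //; first exact: colz.
apply/(ZW _ (y' - y')); last by rewrite subrr; apply: ideal0.
by apply: ZB => //; apply: Zz.
Qed.

(** This is the freeness of [C/C^2] over [R/C]: two expressions of one element differ by a Koszul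
    relation, whose coordinates lie in the ideal. *)
Lemma regular_vec_unique f a a' : regular_vec f -> dot f a = dot f a' ->
  [/\ vec_ideal f (a.1.1 - a'.1.1), vec_ideal f (a.1.2 - a'.1.2)
     & vec_ideal f (a.2 - a'.2)].
Proof.
move=> reg e; have [|b eb] := @koszul3_exact _ f (a - a') reg.
  have -> : dot f (a - a') = dot f a - dot f a' by rewrite /dot /=; ring.
  by rewrite e subrr.
have [f1 f2 f3] := vec_ideal_gens f; have iC := vec_ideal_ideal f.
have [/= -> -> ->] := vec_eq eb.
by split; apply: idealB => //; apply: idealMr.
Qed.

Definition vcomp (v : R * R * R) (a : 'I_3) : R :=
  match val a with 0%N => v.1.1 | 1%N => v.1.2 | _ => v.2 end.

Lemma dotE f v : dot f v = \sum_a vcomp f a * vcomp v a.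
Proof. by rewrite !big_ord_recl big_ord0 /dot /vcomp /= addr0 addrA. Qed.

Lemma vec_ideal_comp f a : vec_ideal f (vcomp f a).
Proof.
have [f1 f2 f3] := vec_ideal_gens f.
by rewrite /vcomp; case: a => [[|[|[|a]]]] //=.
Qed.

Lemma vcomp_unique f u v a : regular_vec f -> dot f u = dot f v ->
  vec_ideal f (vcomp u a - vcomp v a).
Proof.
move=> reg /(regular_vec_unique reg) [e1 e2 e3].
by rewrite /vcomp; case: a => [[|[|[|a]]]] //=.
Qed.

End Excess.

(** Rank-nullity: the rows of [B] are independent solutions of a homogeneous system with unknowns
    indexed by [S] and equations by [T]. *)
Lemma kernel_family (k : fieldType) (S T : finType) (A : S -> T -> k) :
  exists r (B : 'I_r -> S -> k), [/\ (#|S| <= r + #|T|)%N,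
    forall i t, \sum_s B i s * A s t = 0 &
    forall d : 'I_r -> k, (forall s, \sum_i d i * B i s = 0) -> forall i, d i = 0].
Proof.
pose M : 'M_(#|S|, #|T|) := \matrix_(i, j) A (enum_val i) (enum_val j).
exists (\rank (kermx M)), (fun i s => row_base (kermx M) i (enum_rank s)); split.
- by rewrite mxrank_ker; have := rank_leq_col M; lia.
- move=> i t; have : row_base (kermx M) *m M = 0.
    by apply/sub_kermxP; rewrite eq_row_base.
  move=> /matrixP/(_ i (enum_rank t)); rewrite !mxE => e0; rewrite -[RHS]e0.
  rewrite (reindex _ (onW_bij _ (enum_val_bij S))) /=; apply: eq_bigr => s _.
  by rewrite [M _ _]mxE enum_rankK enum_valK.
- move=> d d0; have : (\row_i d i) *m row_base (kermx M) = 0.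
    apply/rowP=> j; rewrite !mxE -[RHS](d0 (enum_val j)).
    by apply: eq_bigr => i _; rewrite mxE enum_valK.
  move/eqP; rewrite mulmx_free_eq0 ?row_base_free // => /eqP/rowP e i.
  by have := e i; rewrite !mxE.
Qed.

(** * Invariance under a direct link *)

Section ExcessLink.
Variables (k : fieldType) (R : comAlgType k).
Implicit Types (I J C M : R -> Prop) (f g : R * R * R) (x y z : R).

Definition coord M m (e : 'I_m -> R) x : 'I_m -> k :=
  epsilon (inhabits (fun=> 0)) (fun c => M (x - \sum_i c i *: e i)).

Section Coordinates.
Variables (M : R -> Prop) (m : nat) (e : 'I_m -> R).
Hypotheses (iM : is_ideal M) (be : basis_mod (fun=> True) M e).

Lemma coordP x : M (x - \sum_i coord M e x i *: e i).
Proof.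
case: be => _ _ /(_ x I) [c Mc].
exact: (epsilon_spec (inhabits (fun=> 0)) (fun c => M (x - \sum_i c i *: e i))
  (ex_intro _ c Mc)).
Qed.

Lemma coord_unique x c : M (x - \sum_i c i *: e i) -> forall i, coord M e x i = c i.
Proof.
move=> Mc i; case: be => _ inde _; apply/eqP; rewrite -subr_eq0; apply/eqP.
apply: (inde (fun i => coord M e x i - c i)).
have -> : \sum_i (coord M e x i - c i) *: e i =
    (x - \sum_i c i *: e i) - (x - \sum_i coord M e x i *: e i).
  rewrite opprB addrC addrA subrK -sumrB.
  by apply: eq_bigr => j _; rewrite scalerBl.
by apply: idealB => //; apply: coordP.
Qed.

Lemma coord_mod x y : M (x - y) -> forall i, coord M e x i = coord M e y i.
Proof.
move=> Mxy; apply: coord_unique; have := idealD iM Mxy (coordP y).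
by rewrite addrA subrK.
Qed.

Lemma coord_linear i : linear_on (fun=> True) ((coord M e)^~ i).
Proof.
move=> c x y _ _; rewrite (@coord_unique _ (fun i => c * coord M e x i + coord M e y i)) //.
have -> : c *: x + y - \sum_i (c * coord M e x i + coord M e y i) *: e i =
  c *: (x - \sum_i coord M e x i *: e i) + (y - \sum_i coord M e y i *: e i).
  rewrite scalerBr scaler_sumr addrACA -opprD -big_split; congr (_ - _).
  by apply: eq_bigr => j _; rewrite scalerDl scalerA.
by apply: (ideal_subspace iM).2; apply: coordP.
Qed.

Lemma coord_basis i j : coord M e (e j) i = (i == j)%:R.
Proof.
apply: (@coord_unique _ (fun i => (i == j)%:R)).
rewrite (bigD1 j) //= eqxx scale1r big1 ?addr0 ?subrr; first exact: ideal0.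
by move=> l /negPf ->; rewrite scale0r.
Qed.

Lemma coord0 x i : M x -> coord M e x i = 0.
Proof.
move=> Mx; rewrite (@coord_unique _ (fun=> 0)) // big1 ?subr0 // => j _.
by rewrite scale0r.
Qed.

End Coordinates.

Section Link.
Variables (f : R * R * R) (J : R -> Prop).
Hypothesis reg : regular_vec f.
Let C := vec_ideal f.
Let J' := colon C J.
Hypotheses (iJ : is_ideal J) (sCJ : sub_ideal C J).

Let iC : is_ideal C := vec_ideal_ideal f.
Let iJ' : is_ideal J' := colon_ideal J iC.
Let sCJ' : sub_ideal C J'. Proof. by move=> x Cx y _; apply: idealMr. Qed.

(** Chosen coefficients, which are canonical only modulo [C]; hence the congruences below. *)
Definition vcoef z : R * R * R := epsilon (inhabits 0) (fun v => z = dot f v).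

Lemma vcoefP z : C z -> z = dot f (vcoef z).
Proof.
move/vec_idealP => [v ev].
exact: (epsilon_spec (inhabits 0) (fun v => z = dot f v) (ex_intro _ v ev)).
Qed.

Lemma vcoef_linear (c : k) z z' a : C z -> C z' ->
  C (vcomp (vcoef (c *: z + z')) a - (c *: vcomp (vcoef z) a + vcomp (vcoef z') a)).
Proof.
move=> Cz Cz'; have Czz' : C (c *: z + z') by apply: (ideal_subspace iC).2.
have -> : c *: vcomp (vcoef z) a + vcomp (vcoef z') a =
    vcomp (scalev c%:A (vcoef z) + vcoef z') a.
  by rewrite -[c *: vcomp _ _]mulr_algl /vcomp; case: a => [[|[|[|a]]] lt3] /=.
apply: vcomp_unique => //; rewrite -vcoefP //.
have -> : dot f (scalev c%:A (vcoef z) + vcoef z') =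
    c%:A * dot f (vcoef z) + dot f (vcoef z') by rewrite /dot /=; ring.
by rewrite -!vcoefP // mulr_algl.
Qed.

Lemma vcoefM x y a : C x -> C (vcomp (vcoef (x * y)) a - vcomp (vcoef x) a * y).
Proof.
move=> Cx; have Cxy : C (x * y) by apply: idealMr.
have -> : vcomp (vcoef x) a * y = vcomp (scalev y (vcoef x)) a.
  by rewrite mulrC /vcomp; case: a => [[|[|[|a]]] lt3] //=.
apply: vcomp_unique => //; rewrite -vcoefP //.
have -> : dot f (scalev y (vcoef x)) = dot f (vcoef x) * y by rewrite /dot /=; ring.
by rewrite -vcoefP.
Qed.

Lemma vcoef_gen y a b : C (vcomp (vcoef (vcomp f b * y)) a - (a == b)%:R * y).
Proof.
have Cf : C (vcomp f b * y) by apply: idealMr => //; apply: vec_ideal_comp.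
pose v : R * R * R := ((b == 0)%:R * y, (b == 1)%:R * y, (b == 2%:R)%:R * y).
have -> : (a == b)%:R * y = vcomp v a.
  by rewrite /vcomp /v; case: a b {v Cf} => [[|[|[|a]]] lta] [[|[|[|b]]] ltb] //=.
apply: vcomp_unique => //; rewrite -vcoefP // dotE !big_ord_recl big_ord0.
rewrite /vcomp /v /=.
by case: b {v Cf} => [[|[|[|b]]] lt3] //=; rewrite ?mul0r ?mulr0 ?mul1r ?addr0 ?add0r.
Qed.

(** Since [C/CJ'] is isomorphic to [(R/J')^3], these [3 m] functionals are the basis of its dual
    that is dual to the products [f_b e_l]. *)
Lemma coord_vcoefM m (e : 'I_m -> R) a j : basis_mod (fun=> True) J' e ->
  [/\ linear_on C (fun z => coord J' e (vcomp (vcoef z) a) j),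
      (forall x y, C x -> J' y -> coord J' e (vcomp (vcoef (x * y)) a) j = 0) &
      forall b l, coord J' e (vcomp (vcoef (vcomp f b * e l)) a) j
                  = ((a == b) && (j == l))%:R].
Proof.
move=> be; split=> [c z z' Cz Cz'|x y Cx J'y|b l].
- rewrite (coord_mod iJ' be (sCJ' (vcoef_linear c a Cz Cz'))).
  by rewrite (coord_linear iJ' be).
- rewrite (coord_mod iJ' be (sCJ' (vcoefM y a Cx))).
  by apply: (coord0 iJ' be); exact: (idealMl _ iJ' J'y).
- rewrite (coord_mod iJ' be (sCJ' (vcoef_gen (e l) a b))).
  case: eqP => _ /=; first by rewrite mul1r (coord_basis iJ' be).
  by rewrite mul0r (coord0 iJ' be) //; apply: ideal0.
Qed.

(* By the freeness of C/C^2 over R/C. *)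
Lemma balanced_form_lift m (e : 'I_m -> R) b : basis_mod (fun=> True) J' e ->
  balanced_form J J' C b ->
  exists2 l, linear_on C l & forall x y, C x -> J' y -> l (x * y) = b x y.
Proof.
move=> be [lin1 lin2 bal b0].
(* The form [b] is only meaningful with second argument in [J'], so the coefficients of [z] are
   first sent there by a linear projection that is the identity on [J'] and respects congruence
   modulo [C]. *)
pose p x := x - \sum_i coord J' e x i *: e i.
have pJ' x : J' (p x) by exact: (coordP be).
have p_id x : J' x -> p x = x.
  by move=> J'x; rewrite /p big1 ?subr0 // => i _; rewrite (coord0 iJ' be) ?scale0r.
have p_lin c x y : p (c *: x + y) = c *: p x + p y.
  rewrite /p scalerBr scaler_sumr addrACA -opprD -big_split; congr (_ - _).
  by apply: eq_bigr => j _; rewrite (coord_linear iJ' be) // scalerDl scalerA.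
have p_mod x y : C (x - y) -> C (p x - p y).
  move=> Cxy; rewrite /p.
  under eq_bigr do rewrite (coord_mod iJ' be (sCJ' Cxy)).
  by rewrite opprB addrA subrK.
have b_mod x y y' : J x -> J' y -> J' y' -> C (y - y') -> b x y = b x y'.
  move=> Jx J'y J'y' Cyy'; apply/eqP; rewrite -subr_eq0.
  by rewrite -(linear_onB iJ' (lin2 x Jx)) // b0.
have Jf a : J (vcomp f a) by apply/sCJ/vec_ideal_comp.
exists (fun z => \sum_a b (vcomp f a) (p (vcomp (vcoef z) a))).
  move=> c z z' Cz Cz'; rewrite mulr_sumr -big_split; apply: eq_bigr => a _ /=.
  rewrite -lin2 // -p_lin; apply: b_mod => //; apply: p_mod.
  exact: vcoef_linear.
move=> x y Cx J'y.
have J'c a : J' (vcomp (vcoef x) a * y) by exact: (idealMl _ iJ' J'y).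
have -> : b x y = \sum_a b (vcomp f a) (vcomp (vcoef x) a * y).
  have -> : \sum_a b (vcomp f a) (vcomp (vcoef x) a * y) =
      \sum_a b (vcomp (vcoef x) a * vcomp f a) y by apply: eq_bigr => a _; rewrite bal.
  rewrite [in LHS](vcoefP Cx) dotE.
  have [] // : b (\sum_a vcomp f a * vcomp (vcoef x) a) y =
     \sum_a b (vcomp (vcoef x) a * vcomp f a) y /\ J (\sum_a vcomp f a * vcomp (vcoef x) a).
  elim/big_rec2: _ => [|i u v _ [<- Jv]].
    by split; [apply: linear_on0 iJ (lin1 _ J'y)|apply: ideal0].
  have Jfi : J (vcomp f i * vcomp (vcoef x) i) by apply: idealMr.
  by rewrite (linear_onD (lin1 _ J'y)) // [vcomp f i * _]mulrC; split=> //;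
    apply: idealD => //; rewrite mulrC.
apply: eq_bigr => a _; rewrite -[vcomp (vcoef x) a * y in RHS]p_id //.
by apply: b_mod => //; apply: p_mod; apply: vcoefM.
Qed.

(** Pairs [(b, l)] are counted from both sides. Given [b], the functional [l] is free up to the dual
    of [C/CJ'], of dimension [3 dim R/J']; seen from [J'], the freedom is [3 dim R/J]. As
    [dim R/J' + dim J'/C = dim R/J + dim J/C], the excess over [3 dim w] does not drop. *)
Lemma excess_link : finite_codim C -> J = colon C J' -> excess J C -> excess J' C.
Proof.
move=> finC JE [w [n [e [F [be ltwn balF freeF]]]]].
have sub_codim (W : R -> Prop) : sub_ideal C W -> finite_codim W.
  move=> sCW; case: finC => B bB; exists B => p h indh; apply: (bB p h) => c Cc.
  exact: indh _ (sCW _ Cc).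
have spT : subspace (fun _ : R => True) by [].
have sp I : is_ideal I -> subspace I := @ideal_subspace _ _ I.
have [m [h bh]] := basis_mod_exists (fun=> True) (sp _ iJ') (sub_codim _ sCJ').
have [m' [h' bh']] := basis_mod_exists (fun=> True) (sp _ iJ) (sub_codim _ sCJ).
have [w' [e' be']] := basis_mod_exists J (sp _ iC) finC.
have dim_eq : (m + w = m' + w')%N.
  have b1 := basis_mod_cat spT (sp _ iJ') (sp _ iC) sCJ' (fun _ _ => I) bh be.
  have b2 := basis_mod_cat spT (sp _ iJ) (sp _ iC) sCJ (fun _ _ => I) bh' be'.
  apply/eqP; rewrite eqn_leq; apply/andP; split.
    by apply: (indep_mod_le (sp _ iC) b2 _ (let: And3 _ i _ := b1 in i)).
  by apply: (indep_mod_le (sp _ iC) b1 _ (let: And3 _ i _ := b2 in i)).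
have [L HL] : exists L : 'I_n -> R -> k, forall i, linear_on C (L i) /\
    forall x y, C x -> J' y -> L i (x * y) = F i x y.
  apply: (@fin_all_exists _ (fun=> R -> k) (fun i l => linear_on C l /\
    forall x y, C x -> J' y -> l (x * y) = F i x y)) => i.
  by have [l] := balanced_form_lift bh (balF i); exists l.
(* The index set [S] enumerates pairs [(b, l)]: the lifted forms [(F i, L i)] and the pairs with
   zero form and [l] one of the [3 m] functionals on [C/CJ']. [lam] is the functional of a pair and
   [G] its exchanged form. *)
pose mu (aj : 'I_3 * 'I_m) z := coord J' h (vcomp (vcoef z) aj.1) aj.2.
pose S : finType := ('I_n + 'I_3 * 'I_m)%type.
pose T : finType := ('I_3 * 'I_m')%type.
pose lam (s : S) z := match s with inl i => L i z | inr aj => mu aj z end.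
pose G (s : S) y x := match s with inl i => L i (x * y) - F i x y
                                 | inr aj => mu aj (x * y) end.
have JJ'C x y : J x -> J' y -> C (x * y) by move=> Jx J'y; rewrite mulrC; apply: J'y.
have lam_lin s : linear_on C (lam s).
  case: s => [i|[a j]] /=; first by case: (HL i).
  by case: (coord_vcoefM a j bh).
have GE s x y : J x -> C y -> G s y x = lam s (x * y).
  by move=> Jx Cy; case: s => [i|//] /=; case: (balF i) => _ _ _ -> //; rewrite subr0.
have G0 s x y : C x -> J' y -> G s y x = 0.
  move=> Cx J'y; case: s => [i|[a j]] /=; first by rewrite (HL i).2 // subrr.
  by case: (coord_vcoefM a j bh) => _ + _; apply.
have G_lin1 s x : J x -> linear_on J' ((G s)^~ x).
  move=> Jx c y y' J'y J'y'; have Cy := JJ'C x y Jx J'y; have Cy' := JJ'C x y' Jx J'y'.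
  have -> : G s (c *: y + y') x = lam s (c *: (x * y) + x * y') -
      (if s is inl i then F i x (c *: y + y') else 0).
    by rewrite scalerAr -mulrDr; case: s => //= aj; rewrite subr0.
  rewrite lam_lin //; case: s => [i|aj] /=; last by rewrite subr0.
  by case: (balF i) => _ lin _ _; rewrite lin //; ring.
have G_lin2 s y : J' y -> linear_on J (G s y).
  move=> J'y c x x' Jx Jx'; have Cx := JJ'C x y Jx J'y; have Cx' := JJ'C x' y Jx' J'y.
  have -> : G s y (c *: x + x') = lam s (c *: (x * y) + x' * y) -
      (if s is inl i then F i (c *: x + x') y else 0).
    by rewrite scalerAl -mulrDl; case: s => //= aj; rewrite subr0.
  rewrite lam_lin //; case: s => [i|aj] /=; last by rewrite subr0.
  by case: (balF i) => lin _ _ _; rewrite lin //; ring.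
have G_bal s r x y : J x -> J' y -> G s (r * y) x = G s y (r * x).
  move=> Jx J'y; rewrite /G; have -> : x * (r * y) = r * x * y by ring.
  by case: s => [i|//]; have [_ _ bal _] := balF i; rewrite bal.
(* Requiring the functional to vanish on the [f_a h'_j] costs [3 m'] equations and makes the passage
   from pairs to exchanged forms injective. *)
have [r [B [cardB BA freeB]]] :=
  kernel_family (fun (s : S) (t : T) => lam s (vcomp f t.1 * h' t.2)).
exists w', r, e', (fun i y x => \sum_s B i s * G s y x).
have cJ : colon C J' = J by [].
split.
- by rewrite cJ.
- move: cardB; rewrite card_sum !card_prod !card_ord; lia.
- move=> i; rewrite cJ; split.
  + move=> x Jx c y y' J'y J'y'; rewrite mulr_sumr -big_split; apply: eq_bigr => s _ /=.
    by rewrite (G_lin1 s x) //; ring.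
  + move=> y J'y c x x' Jx Jx'; rewrite mulr_sumr -big_split; apply: eq_bigr => s _ /=.
    by rewrite (G_lin2 s y) //; ring.
  + by move=> q y x J'y Jx; apply: eq_bigr => s _; rewrite G_bal.
  + by move=> y x J'y Cx; rewrite big1 // => s _; rewrite G0 ?mulr0.
rewrite cJ => d dG; pose c s := \sum_i d i * B i s.
suffices c0 : forall s, c s = 0 by apply: freeB.
have cG x y : J x -> J' y -> \sum_s c s * G s y x = 0.
  move=> Jx J'y; rewrite -[RHS](dG y x J'y Jx).
  under eq_bigr do rewrite /c mulr_suml.
  rewrite exchange_big; apply: eq_bigr => i _; rewrite mulr_sumr.
  by apply: eq_bigr => s _; rewrite mulrA.
pose Lam z := \sum_s c s * lam s z.
have Lam_lin : linear_on C Lam.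
  move=> a z z' Cz Cz'; rewrite /Lam mulr_sumr -big_split; apply: eq_bigr => s _ /=.
  by rewrite lam_lin //; ring.
have Lam_J x y : J x -> C y -> Lam (x * y) = 0.
  move=> Jx Cy; rewrite -[RHS](cG x y Jx (sCJ' Cy)); apply: eq_bigr => s _.
  by rewrite GE.
have Lam_h a j : Lam (vcomp f a * h' j) = 0.
  rewrite /Lam; under eq_bigr do rewrite /c mulr_suml.
  rewrite exchange_big big1 // => i _.
  under eq_bigr do rewrite -mulrA; rewrite -mulr_sumr.
  by have := BA i (a, j); rewrite /= => ->; rewrite mulr0.
have Cf x a : C (vcomp f a * x) by apply: idealMr => //; apply: vec_ideal_comp.
(* [C] is spanned by [CJ] and the [f_a h'_j]. The functional vanishes on [CJ] because the exchanged
   form is zero and the [F i] vanish on [J x C]. *)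
have Lam0 z : C z -> Lam z = 0.
  have Lamf a x : Lam (vcomp f a * x) = 0.
    pose q := \sum_i coord J h' x i *: h' i.
    have -> : x = (x - q) + q by rewrite subrK.
    rewrite mulrDr (linear_onD Lam_lin) //.
    have -> : Lam (vcomp f a * (x - q)) = 0.
      by rewrite mulrC; apply: Lam_J; [apply: (coordP bh')|apply: vec_ideal_comp].
    rewrite add0r.
    rewrite mulr_sumr; under eq_bigr do rewrite -scalerAr.
    by rewrite (linear_on_sum _ iC Lam_lin) // big1 // => i _; rewrite Lam_h mulr0.
  move=> /vcoefP ->; rewrite dotE.
  have [] // : Lam (\sum_a vcomp f a * vcomp (vcoef z) a) = 0 /\
               C (\sum_a vcomp f a * vcomp (vcoef z) a).
  elim/big_rec: _ => [|a u _ [Lu Cu]]; first by split; [apply: linear_on0 Lam_lin|apply: ideal0].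
  by rewrite (linear_onD Lam_lin) // Lamf Lu addr0; split=> //; apply: idealD.
have cF i : c (inl i) = 0.
  apply: (freeF (fun i => c (inl i))) => x y Jx J'y.
  have := cG x y Jx J'y; have := Lam0 _ (JJ'C x y Jx J'y).
  rewrite /Lam !big_sumType /= => e1 e2.
  apply: (eq_from_sub (etrans e1 (esym e2))); rewrite subr0 opprD addrACA subrr addr0.
  by rewrite -sumrB; apply: eq_bigr => j _; ring.
case=> [//|[a j]]; rewrite -[RHS](Lam0 (vcomp f a * h j)) //.
rewrite /Lam big_sumType /= big1 ?add0r; last by move=> i _; rewrite cF mul0r.
rewrite (bigD1 (a, j)) //= big1 ?addr0 => [|[b l] ne].
  by rewrite /mu; have [_ _ ->] := coord_vcoefM a j bh; rewrite !eqxx mulr1.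
rewrite /mu; have [_ _ ->] := coord_vcoefM b l bh.
by case: eqP => [eb|]; case: eqP => [el|]; rewrite ?mulr0 //= eb el eqxx in ne *.
Qed.

End Link.

(** A balanced form on [C x R] that vanishes on [C x C] is determined by its [3 w] values at the
    pairs [(f_a, e_i)], so more than [3 w] such forms are dependent. *)
Lemma not_excess_self f : regular_vec f -> ~ excess (vec_ideal f) (vec_ideal f).
Proof.
move=> reg; set C := vec_ideal f; have iC : is_ideal C := vec_ideal_ideal f.
have CC x : colon C C x by move=> y Cy; apply: idealMl.
case=> w [n [e [F [[_ inde spane] ltwn balF freeF]]]].
have be : basis_mod (fun=> True) C e by split=> // u _; apply: spane.
have [r [B [cardB BA freeB]]] :=
  kernel_family (fun (s : 'I_n) (t : 'I_3 * 'I_w) => F s (vcomp f t.1) (e t.2)).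
have r_gt0 : (0 < r)%N.
  by move: cardB; rewrite card_prod !card_ord; lia.
pose i0 := Ordinal r_gt0.
suffices B0 s : B i0 s = 0.
  have := freeB (fun i => (i == i0)%:R) _ i0; rewrite eqxx => H.
  suffices /eqP : (1 : k) = 0 by rewrite oner_eq0.
  apply: H => s; rewrite (bigD1 i0) //= B0 mulr0 big1 ?addr0 // => i /negPf ->.
  by rewrite mul0r.
apply: freeF s => x y Cx _.
pose b u v := \sum_s B i0 s * F s u v.
have b_lin1 v : linear_on C (b^~ v).
  move=> c u u' Cu Cu'; rewrite /b mulr_sumr -big_split; apply: eq_bigr => s _ /=.
  by case: (balF s) => lin _ _ _; rewrite lin //; ring.
have b_lin2 u : C u -> linear_on (fun=> True) (b u).
  move=> Cu c v v' _ _; rewrite /b mulr_sumr -big_split; apply: eq_bigr => s _ /=.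
  by case: (balF s) => _ lin _ _; rewrite lin //; ring.
have b0 u v : C u -> C v -> b u v = 0.
  by move=> Cu Cv; rewrite /b big1 // => s _; case: (balF s) => _ _ _ ->; rewrite ?mulr0.
have b_bal q u v : C u -> b (q * u) v = b u (q * v).
  by move=> Cu; apply: eq_bigr => s _; case: (balF s) => _ _ -> //.
have Cf a : C (vcomp f a) by apply: vec_ideal_comp.
have bf a v : b (vcomp f a) v = 0.
  pose q := \sum_i coord C e v i *: e i.
  have iT : is_ideal (fun _ : R => True) by [].
  have -> : v = (v - q) + q by rewrite subrK.
  rewrite (linear_onD (b_lin2 _ (Cf a))) // b0 //; last exact: (coordP be).
  rewrite add0r (linear_on_sum _ iT (b_lin2 _ (Cf a))) // big1 // => i _.
  by rewrite /b (BA i0 (a, i)) mulr0.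
change (b x y = 0); rewrite (vcoefP Cx) dotE.
have [] // : b (\sum_a vcomp f a * vcomp (vcoef f x) a) y = 0 /\
             C (\sum_a vcomp f a * vcomp (vcoef f x) a).
elim/big_rec: _ => [|a u _ [bu Cu]]; first by split; [apply: linear_on0 (b_lin1 y)|apply: ideal0].
have Cfa : C (vcomp f a * vcomp (vcoef f x) a) by apply: idealMr.
rewrite (linear_onD (b_lin1 y)) // bu addr0 mulrC b_bal // bf; split=> //.
by apply: idealD => //; rewrite mulrC.
Qed.

End ExcessLink.

(** * Regular sequences in polynomial rings *)

Section Growth.
Variables (k : fieldType) (q : nat).
Local Notation R := {mpoly k[q]}.
Implicit Types (s : seq R) (I : R -> Prop).

(** Since [msize] is the degree plus one for a nonzero polynomial, a bound [d] means degree below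
    [d], and [e.+1] means degree at most [e]. *)
Lemma msizeM_leD (p r : R) d e : (msize p <= d)%N -> (msize r <= e.+1)%N ->
  (msize (r * p) <= d + e)%N.
Proof.
move=> ped red; have [->|nzp] := eqVneq p 0; first by rewrite mulr0 msize0.
have [->|nzr] := eqVneq r 0; first by rewrite mul0r msize0.
rewrite msizeM //; move: ped red; set a := mmeasure _ _; set b := mmeasure _ _.
by lia.
Qed.

(** The family consists of the [f ^ i * v_j] with [i < N]. Modulo [I'] only the terms with [i = 0]
    survive in a relation, so their coefficients vanish; then [f] is cancelled modulo [I]. *)
Lemma indep_mod_shift I I' (f : R) e n d (v : 'I_n -> R) N :
  is_ideal I -> is_ideal I' -> sub_ideal I I' -> I' f -> (forall x, I (f * x) -> I x) ->
  (msize f <= e.+1)%N -> (forall i, (msize (v i) <= d)%N) -> indep_mod I' v ->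
  exists2 w : 'I_(N * n) -> R, indep_mod I w & forall i, (msize (w i) <= d + N * e)%N.
Proof.
move=> iI iI' sII' I'f nzd fe vd indv.
elim: N => [|N [w indw wd]].
  by rewrite mul0n; exists (fun=> 0) => [c _ []|[]].
rewrite mulSn; exists (family_cat v (fun i => f * w i)) => [c|i]; last first.
  rewrite /family_cat; case: split => j; first by apply: leq_trans (vd j) _; lia.
  by apply: leq_trans (msizeM_leD (wd j) fe) _; lia.
rewrite family_catE => Ic.
have fsum : \sum_i c (rshift n i) *: (f * w i) = f * \sum_i c (rshift n i) *: w i.
  by rewrite mulr_sumr; apply: eq_bigr => i _; rewrite scalerAr.
have cl i : c (lshift (N * n) i) = 0.
  apply: (indv (fun i => c (lshift (N * n) i))).
  rewrite -[X in I' X](addrK (\sum_i c (rshift n i) *: (f * w i))).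
  by apply: idealB => //; [apply: sII'|rewrite fsum; apply: idealMr].
have cr i : c (rshift n i) = 0.
  apply: (indw (fun i => c (rshift n i))); apply: nzd; rewrite -fsum.
  by move: Ic; rewrite [X in X + _]big1 ?add0r // => j _; rewrite cl scale0r.
by move=> i; rewrite -(splitK i); case: (split i) => j; [apply: cl|apply: cr].
Qed.

(** Polynomials of degree below [d] only involve exponents from a box with [d ^ q] elements. *)
Lemma indep_mod0_le d n (v : 'I_n -> R) : indep_mod (ideal_gen [::]) v ->
  (forall i, (msize (v i) <= d)%N) -> (n <= d ^ q)%N.
Proof.
move=> indv vd.
have [r [B [cardB BA freeB]]] := kernel_family
  (fun (i : 'I_n) (g : {ffun 'I_q -> 'I_d}) => (v i)@_[multinom (g j : nat) | j < q]).
move: cardB; rewrite card_ffun !card_ord; suff: (r = 0)%N by move=> ->.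
apply/eqP; rewrite -leqn0 leqNgt; apply/negP => r_gt0.
suff /eqP : (1 : k) = 0 by rewrite oner_eq0.
have := freeB (fun i => (i == Ordinal r_gt0)%:R) _ (Ordinal r_gt0); rewrite eqxx; apply.
move=> s; rewrite (bigD1 (Ordinal r_gt0)) //= big1 ?addr0 => [|i /negPf ->]; last by rewrite mul0r.
rewrite (indv (B (Ordinal r_gt0))) ?mulr0 //; apply/ideal_gen_nil/mpolyP => m.
rewrite raddf_sum mcoeff0 /=; under eq_bigr do rewrite mcoeffZ.
have [ltmd|lemd] := ltnP (mdeg m) d.
  have ltm j : (m j < d)%N.
    by apply: leq_ltn_trans ltmd; rewrite mdegE (bigD1 j) //= leq_addr.
  rewrite -[RHS](BA (Ordinal r_gt0) [ffun j => Ordinal (ltm j)]).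
  apply: eq_bigr => i _; congr (_ * (v i)@_ _).
  by apply/mnmP => j; rewrite mnmE ffunE.
rewrite big1 // => i _; rewrite memN_msupp_eq0 ?mulr0 //.
by apply: msize_mdeg_ge; apply: leq_trans lemd.
Qed.

(* The products of monomials in s of exponents < N with the v i are independent. *)
Lemma regular_growth s e n d (v : 'I_n -> R) N : regular_sequence s ->
  (forall i, (i < size s)%N -> (msize s`_i <= e.+1)%N) ->
  (forall i, (msize (v i) <= d)%N) -> indep_mod (ideal_gen s) v ->
  (N ^ size s * n <= (d + size s * (N * e)) ^ q)%N.
Proof.
move=> [reg _] se vd indv.
have gen j : is_ideal (ideal_gen (take j s)) by apply: ideal_gen_ideal.
suff H j : (j <= size s)%N -> exists2 w : 'I_(N ^ j * n) -> R,
    indep_mod (ideal_gen (take (size s - j) s)) w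
    & forall i, (msize (w i) <= d + j * (N * e))%N.
  have [w] := H _ (leqnn _); rewrite subnn take0; exact: indep_mod0_le.
elim: j => [|j IH] ltj.
  by rewrite expn0 mul1n subn0 take_size; exists v => // i; rewrite addn0.
have [w indw wd] := IH (ltnW ltj).
have ltjs : (size s - j.+1 < size s)%N by lia.
have E : (size s - j = (size s - j.+1).+1)%N by lia.
rewrite E in indw.
have [||w' indw' w'd] := @indep_mod_shift _ _ s`_(size s - j.+1) e _ _ w N
  (gen (size s - j.+1)%N) (gen (size s - j.+1).+1) _ _ (reg _ ltjs) (se _ ltjs) wd indw.
- apply: ideal_gen_sub => // i; rewrite size_take => lti.
  have lti' : (i < size s - j.+1)%N by move: lti; case: ifP; lia.
  have -> : (take (size s - j.+1) s)`_i = (take (size s - j.+1).+1 s)`_i.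
    by rewrite !nth_take // ltnW.
  apply: ideal_gen_nth; rewrite size_take; case: ifP => [_|_].
    exact: ltnW.
  exact: leq_trans lti' (leq_subr _ _).
- rewrite -[X in ideal_gen _ X](nth_take 0 (ltnSn (size s - j.+1))).
  by apply: ideal_gen_nth; rewrite size_take; case: ifP.
rewrite expnS -mulnA; exists w' => // i; apply: leq_trans (w'd i) _; lia.
Qed.

Lemma msize_bound n (v : 'I_n -> R) : exists d, forall i, (msize (v i) <= d)%N.
Proof. by exists (\max_i msize (v i)) => i; apply: (leq_bigmax i). Qed.

Lemma msize_bound_seq s : exists e, forall i, (i < size s)%N -> (msize s`_i <= e.+1)%N.
Proof.
have [d dP] := msize_bound (fun i : 'I_(size s) => s`_i).
by exists d => i lti; apply: leqW; apply: (dP (Ordinal lti)).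
Qed.

Lemma regular_sequence_size s : regular_sequence s -> (size s <= q)%N.
Proof.
move=> reg; have [e se] := msize_bound_seq s; rewrite leqNgt; apply/negP => ltq.
(* For the single vector 1, growth gives [N ^ r <= (N (1 + r e)) ^ q]. This [N] violates it because
   [r > q]. *)
set r := size s in ltq se; pose N := ((1 + r * e) ^ q).+1.
have ind1 : indep_mod (ideal_gen s) (fun _ : 'I_1 => 1 : R).
  move=> c; rewrite big_ord1 => sc i; rewrite ord1; apply/eqP/negP => /negP nz.
  apply: reg.2; rewrite -[1](_ : (c ord0)^-1%:MP * (c ord0 *: 1) = _).
    by apply: idealMl => //; apply: ideal_gen_ideal.
  by rewrite mul_mpolyC scalerA mulVf // scale1r.
have := @regular_growth s e 1 1 _ N reg se (fun=> _) ind1; rewrite msize1 => /(_ (fun=> isT)).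
rewrite muln1 -/r; apply/negP; rewrite -ltnNge.
have mono a b n : (a <= b -> a ^ n <= b ^ n)%N.
  by move=> leab; elim: n => // n IH; rewrite !expnS leq_mul.
apply: (@leq_ltn_trans ((N * (1 + r * e)) ^ q)); first by apply: mono; nia.
rewrite expnMn; apply: (@leq_trans (N ^ q.+1)); last by rewrite leq_pexp2l.
by rewrite expnSr ltn_pmul2l ?expn_gt0.
Qed.

Lemma regular_sequence_codim s : regular_sequence s -> size s = q ->
  finite_codim (ideal_gen s).
Proof.
move=> reg sq; have [e se] := msize_bound_seq s; exists ((1 + q * e) ^ q)%N => n v indv.
(* As [N > d], the growth bound is at most [(N (1 + q e)) ^ q]; dividing by [N ^ q] removes all
   dependence on [v]. *)
have [d vd] := msize_bound v; pose N := d.+1.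
have mono a b p : (a <= b -> a ^ p <= b ^ p)%N.
  by move=> leab; elim: p => // p IH; rewrite !expnS leq_mul.
have := regular_growth N reg se vd indv; rewrite sq => le1.
have le2 : ((d + q * (N * e)) ^ q <= N ^ q * (1 + q * e) ^ q)%N.
  by rewrite -expnMn; apply: mono; rewrite /N; nia.
by have := leq_trans le1 le2; rewrite leq_pmul2l ?expn_gt0.
Qed.

End Growth.

(** * Linkage classes in k[a,b,c] *)

Section Class.
Variable k : fieldType.
Local Notation R := {mpoly k[3]}.
Implicit Types (s : seq R) (I J C : R -> Prop).

Lemma eq_idealE (A : comNzRingType) (I J : A -> Prop) : eq_ideal I J -> I = J.
Proof.
by move=> e; apply: functional_extensionality => x; apply: propositional_extensionality.
Qed.

(** Growth of degrees excludes more than three elements. Fewer are excluded by grade: [x] is a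
    nonzero class modulo [s] killed by a regular sequence of length 3. *)
Lemma regular_sequence_length3 s (g : R * R * R) x : regular_sequence s ->
  regular_vec g -> ~ ideal_gen s x -> ideal_gen s (x * g.1.1) ->
  ideal_gen s (x * g.1.2) -> ideal_gen s (x * g.2) ->
  exists2 f, regular_vec f & ideal_gen s = vec_ideal f /\ finite_codim (ideal_gen s).
Proof.
move=> reg regg nx x1 x2 x3; have sz := regular_sequence_size reg.
have fin := regular_sequence_codim reg.
move: s reg nx x1 x2 x3 sz fin => [|f1 [|f2 [|f3 [|f4 s]]]] //= reg nx x1 x2 x3 _ fin.
- case: nx; apply/ideal_gen_nil; case: regg => [[r _] _]; apply: r.
  by rewrite mulrC; apply/ideal_gen_nil.
- by case: nx; apply: colon_regular1 x1 x2 x3 => //; apply: regular1P reg.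
- by case: nx; apply: colon_regular2 x1 x2 x3 => //; apply: regular2P reg.
- by exists (f1, f2, f3); [apply: regular3P reg|split=> //; apply: fin].
Qed.

Definition has_excess J := is_ideal J /\ exists f : R * R * R,
  [/\ regular_vec f, sub_ideal (vec_ideal f) J & excess J (vec_ideal f)].

Lemma has_excess_linked J J' : directly_linked J J' -> has_excess J -> has_excess J'.
Proof.
move=> [[_ J1] [iJ' J'1] [C [[s reg Cs] sCJ sCJ' eJ' eJ]]] [iJ [g [regg sgJ exJ]]].
have {}Cs := eq_idealE Cs; subst C; have {}eJ' := eq_idealE eJ'; have {}eJ := eq_idealE eJ.
have iC := ideal_gen_ideal s; have [g1 g2 g3] := vec_ideal_gens g.
(* If [J'] were contained in [C], then 1 would lie in [C : J' = J]. *)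
have [x J'x nCx] : exists2 x, J' x & ~ ideal_gen s x.
  apply: NNPP => none; apply: J1; rewrite eJ => x J'x; rewrite mul1r.
  by apply: NNPP => nCx; apply: none; exists x.
have Cx y : J y -> ideal_gen s (x * y) by move: J'x; rewrite eJ'; apply.
have [f regf [Ef fin]] := regular_sequence_length3 reg regg nCx
  (Cx _ (sgJ _ g1)) (Cx _ (sgJ _ g2)) (Cx _ (sgJ _ g3)).
rewrite Ef in sCJ sCJ' eJ' eJ fin.
split=> //; exists f; split=> //; rewrite eJ'; apply: excess_link => //; first by rewrite -eJ'.
exact: excess_exchange exJ.
Qed.

(** With [x = 1], the length criterion shows that [J] is generated by three elements. The exchange
    then allows [J] itself as the complete intersection inside [J]. *)
Lemma complete_intersection_no_excess J : complete_intersection J -> ~ has_excess J.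
Proof.
move=> [s reg Js] [iJ [g [regg sgJ exJ]]]; have {}Js := eq_idealE Js; subst J.
have [g1 g2 g3] := vec_ideal_gens g.
have [||||f regf [Ef fin]] := @regular_sequence_length3 s g 1 reg regg; rewrite ?mul1r.
- exact: reg.2.
- exact: sgJ.
- exact: sgJ.
- exact: sgJ.
apply: (not_excess_self regf); rewrite Ef in iJ sgJ exJ.
exact: excess_exchange exJ.
Qed.

Theorem has_excess_not_licci J : has_excess J -> ~ licci J.
Proof.
move=> exJ [C CI /(@clos_rt_rt1n _ _ _ _) linkJ].
apply: (complete_intersection_no_excess CI).
by elim: linkJ exJ => // I I' C' linkI _ IH /(has_excess_linked linkI).
Qed.

End Class.

(** * Monomial ideals of k[a,b,c] *)

Definition expt : Type := nat * nat * nat.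

Definition tdiv (t u : expt) :=
  [&& (t.1.1 <= u.1.1)%N, (t.1.2 <= u.1.2)%N & (t.2 <= u.2)%N].
Definition tadd (t u : expt) : expt :=
  ((t.1.1 + u.1.1)%N, (t.1.2 + u.1.2)%N, (t.2 + u.2)%N).
(** Truncated, so it is division of monomials only under [tdiv u t]. *)
Definition tsub (t u : expt) : expt :=
  ((t.1.1 - u.1.1)%N, (t.1.2 - u.1.2)%N, (t.2 - u.2)%N).
Definition in_mon (L : seq expt) (u : expt) := has (tdiv^~ u) L.

Definition mm (t : expt) : 'X_{1..3} :=
  [multinom nth 0%N [:: t.1.1; t.1.2; t.2] i | i < 3].

Lemma mmE t : (mm t (@Ordinal 3 0 isT) = t.1.1) * (mm t (@Ordinal 3 1 isT) = t.1.2)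
  * (mm t (@Ordinal 3 2 isT) = t.2).
Proof. by rewrite !mnmE. Qed.

Lemma mm_onto (m : 'X_{1..3}) : exists t, m = mm t.
Proof.
exists (m (@Ordinal 3 0 isT), m (@Ordinal 3 1 isT), m (@Ordinal 3 2 isT)).
apply/mnmP => i; rewrite mnmE.
by case: i => [[|[|[|i]]] lti] //=; congr (m _); apply: val_inj.
Qed.

Lemma mm_inj : injective mm.
Proof.
move=> [[a b] c] [[a' b'] c'] e.
have := (mmE (a, b, c)).1.1; have := (mmE (a, b, c)).1.2; have := (mmE (a, b, c)).2.
by rewrite e !mmE /= => -> -> ->.
Qed.

Lemma mm_add t u : mm (tadd t u) = (mm t + mm u)%MM.
Proof.
apply/mnmP => i; rewrite mnmDE !mnmE.
by case: i => [[|[|[|i]]] lti].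
Qed.

Lemma tsubK t u : tdiv t u -> tadd t (tsub u t) = u.
Proof. by move: t u => [[a b] c] [[a' b'] c'] /and3P[/= ? ? ?]; congr (_, _, _) => /=; lia. Qed.

Lemma taddK t u : tsub (tadd t u) t = u.
Proof. by move: t u => [[a b] c] [[a' b'] c']; congr (_, _, _) => /=; lia. Qed.

Lemma forall_expt (P : pred expt) : (forall i j l, P (i, j, l)) -> forall u, P u.
Proof. by move=> H [[i j] l]. Qed.

Lemma tdiv_addr t u : tdiv t (tadd t u).
Proof. by rewrite /tdiv !leq_addr. Qed.

Section Monomials.
Variable k : fieldType.
Local Notation R := {mpoly k[3]}.
Implicit Types (x y z : R) (t u : expt) (L : seq expt).

Definition mon t : R := 'X_[mm t].

Definition coef x u : k := x@_(mm u).

Lemma monE t : mon t = @va k ^+ t.1.1 * @vb k ^+ t.1.2 * @vc k ^+ t.2.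
Proof.
rewrite /mon mpolyXE_id !big_ord_recl big_ord0 mulr1 mulrA.
by rewrite /va /vb /vc !mnmE /=; congr ('X__ ^+ _ * 'X__ ^+ _ * 'X__ ^+ _); apply: val_inj.
Qed.

Lemma monD t u : mon (tadd t u) = mon t * mon u.
Proof. by rewrite /mon mm_add mpolyXD. Qed.

Lemma mon_neq0 t : mon t != 0.
Proof.
apply/eqP => /mpolyP/(_ (mm t)); rewrite mcoeffX eqxx mcoeff0 => /eqP.
by rewrite oner_eq0.
Qed.

Lemma coef_mon t u : coef (mon t) u = (t == u)%:R.
Proof. by rewrite /coef mcoeffX (inj_eq mm_inj). Qed.

Lemma coef_monM t u x : coef (x * mon t) u = if tdiv t u then coef x (tsub u t) else 0.
Proof.
case: ifPn => [tu|ntu].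
  by rewrite -{1}(tsubK tu) /coef mm_add mcoeffMX.
apply/eqP; rewrite mcoeff_eq0 (perm_mem (msuppMX _ _)).
apply: contra ntu => /mapP [m _]; have [v ->] := mm_onto m.
by rewrite -mm_add => /mm_inj ->; apply: tdiv_addr.
Qed.

Lemma mon_sum x : x = \sum_(m <- msupp x) x@_m *: 'X_[m].
Proof. exact: mpolyE. Qed.

(** Monomial ideals take the form [supp_in (in_mon L)], which turns containments and colons into
    boolean statements about exponents. *)
Definition supp_in (P : pred expt) x := forall u, coef x u != 0 -> P u.

Lemma supp_inP (P : pred expt) x u : supp_in P x -> ~~ P u -> coef x u = 0.
Proof. by move=> Px; apply: contraNeq; apply: Px. Qed.

Lemma supp_in_ext P Q : P =1 Q -> supp_in P = supp_in Q.
Proof.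
move=> PQ; apply: eq_idealE => x; split=> H u /H; by rewrite PQ.
Qed.

Lemma supp_in_mon P t : supp_in P (mon t) <-> P t.
Proof.
split=> [H|Pt u]; first by apply: H; rewrite coef_mon eqxx oner_eq0.
by rewrite coef_mon; case: (t =P u) => [<-|]; rewrite ?eqxx.
Qed.

Lemma supp_in_induct (P : pred expt) (H : R -> Prop) x : supp_in P x -> H 0 ->
  (forall c y z, H y -> H z -> H (c *: y + z)) -> (forall u, P u -> H (mon u)) -> H x.
Proof.
move=> Px H0 HD Hm; rewrite [x]mon_sum big_seq.
elim/big_rec: _ => // m y; rewrite mcoeff_msupp; have [u ->] := mm_onto m.
by move=> /Px Pu Hy; apply: HD => //; apply: Hm.
Qed.

Lemma ideal_gen_mon L : ideal_gen [seq mon t | t <- L] = supp_in (in_mon L).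
Proof.
apply: eq_idealE => x; split=> [[r ->] u|Px].
  rewrite /coef raddf_sum /= => nz.
  have [i nzi] : exists i : 'I_(size [seq mon t | t <- L]),
      coef (r i * [seq mon t | t <- L]`_i) u != 0.
    apply: NNPP => none; move/eqP: nz; apply; apply: big1 => i _.
    by apply/eqP/negPn/negP => nzi; apply: none; exists i.
  have lti : (i < size L)%N by rewrite -(size_map mon); apply: ltn_ord.
  rewrite (nth_map (0, 0, 0)%N) // coef_monM in nzi.
  apply/hasP; exists (nth (0, 0, 0)%N L i); first by rewrite mem_nth.
  by move: nzi; case: ifP => //; rewrite eqxx.
have iL : is_ideal (ideal_gen [seq mon t | t <- L]) by apply: ideal_gen_ideal.
apply: (supp_in_induct Px) => [|c y z Iy Iz|u /hasP [t tL tu]].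
- exact: ideal0.
- exact: (ideal_subspace iL).2.
- rewrite -(tsubK tu) monD mulrC; apply: idealMl => //.
  have <- : [seq mon t | t <- L]`_(index t L) = mon t.
    by rewrite (nth_map (0, 0, 0)%N) ?nth_index // index_mem.
  by apply: ideal_gen_nth; rewrite size_map index_mem.
Qed.

Lemma supp_in_ideal L : is_ideal (supp_in (in_mon L)).
Proof. by rewrite -ideal_gen_mon; apply: ideal_gen_ideal. Qed.

Lemma supp_in_proper L : ~~ in_mon L (0, 0, 0)%N -> ~ supp_in (in_mon L) 1.
Proof.
move=> nL; have -> : 1 = mon (0, 0, 0)%N by rewrite monE !expr0 !mulr1.
by move/supp_in_mon; apply/negP.
Qed.

Definition colon_mon C L : pred expt := fun u => all (fun t => in_mon C (tadd t u)) L.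

Lemma supp_in_monM P t x : supp_in P (x * mon t) <-> supp_in (fun u => P (tadd t u)) x.
Proof.
split=> H u nz.
  apply: H; rewrite coef_monM tdiv_addr taddK //.
move: nz; rewrite coef_monM; case: ifP => [tu|]; last by rewrite eqxx.
by move/H; rewrite tsubK.
Qed.

Lemma colon_monP C L :
  colon (supp_in (in_mon C)) (supp_in (in_mon L)) = supp_in (colon_mon C L).
Proof.
have iC := supp_in_ideal C.
apply: eq_idealE => x; split=> [H u nz|H y].
  apply/allP => t tL; have /H/supp_in_monM : supp_in (in_mon L) (mon t).
    by apply/supp_in_mon/hasP; exists t => //; rewrite /tdiv !leqnn.
  by apply.
rewrite -ideal_gen_mon => Ly; rewrite mulrC; move: y Ly.
suff S : sub_ideal (ideal_gen [seq mon t | t <- L]) (fun y => supp_in (in_mon C) (y * x)).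
  exact: S.
apply: ideal_gen_sub.
  split=> [|y z Hy Hz|r y Hy]; first by rewrite mul0r; apply: ideal0.
    by rewrite mulrDl; exact: (idealD iC).
  by rewrite -mulrA; exact: (idealMl _ iC).
move=> i lti; rewrite size_map in lti; rewrite (nth_map (0, 0, 0)%N) //.
rewrite mulrC; apply/supp_in_monM => u /H /allP; apply.
by rewrite mem_nth.
Qed.

Lemma mon_divides s t x y : (forall u, tdiv t (tadd s u) -> tdiv t u) ->
  x * mon s = y * mon t -> exists z, x = z * mon t.
Proof.
move=> st e; have : ideal_gen [seq mon t | t <- [:: t]] x.
  rewrite ideal_gen_mon => u nz; rewrite /in_mon /= orbF; apply: st.
  move: nz; rewrite -(taddK s u) -[coef _ _]/(if true then _ else 0) -(tdiv_addr s u).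
  by rewrite -coef_monM e coef_monM taddK; case: ifP; rewrite ?eqxx.
by move/ideal_gen1.
Qed.

Definition powers (p q r : nat) : seq expt := [:: (p, 0, 0); (0, q, 0); (0, 0, r)]%N.

Lemma powers_regular p q r : weakly_regular3 (mon (p, 0, 0)%N) (mon (0, q, 0)%N) (mon (0, 0, r)%N).
Proof.
split; first split.
- by move=> x /eqP; rewrite mulf_eq0 (negPf (mon_neq0 _)) /= => /eqP.
- move=> x y; rewrite [LHS]mulrC [RHS]mulrC => /mon_divides [|z ->]; last by exists z; rewrite mulrC.
  by move=> [[a b] c]; rewrite /tdiv /=; lia.
- move=> x y z e.
  have : ideal_gen [seq mon t | t <- [:: (p, 0, 0); (0, q, 0)]%N] x.
    have : ideal_gen [seq mon t | t <- [:: (p, 0, 0); (0, q, 0)]%N] (x * mon (0, 0, r)%N).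
      by apply/ideal_gen2; exists y, z; rewrite mulrC e; ring.
    rewrite !ideal_gen_mon => /supp_in_monM H u /H.
    by case: u => [[a b] c]; rewrite /in_mon /tdiv /=; lia.
  by move/ideal_gen2 => [u [v ->]]; exists u, v; ring.
Qed.

Lemma powers_complete_intersection p q r : (0 < p)%N -> (0 < q)%N -> (0 < r)%N ->
  complete_intersection (supp_in (in_mon (powers p q r))).
Proof.
move=> p0 q0 r0; exists [seq mon t | t <- powers p q r]; last by rewrite ideal_gen_mon.
apply: weakly_regular3_regular; first exact: powers_regular.
have -> : [:: mon (p, 0, 0)%N; mon (0, q, 0)%N; mon (0, 0, r)%N] = [seq mon t | t <- powers p q r] by [].
by rewrite ideal_gen_mon; apply: supp_in_proper; rewrite /in_mon /tdiv /=; lia.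
Qed.

Lemma mon_directly_linked p q r L L' : (0 < p)%N -> (0 < q)%N -> (0 < r)%N ->
  let C := powers p q r in
  ~~ in_mon L (0, 0, 0)%N -> ~~ in_mon L' (0, 0, 0)%N ->
  (forall u, [&& in_mon C u ==> in_mon L u, in_mon C u ==> in_mon L' u,
     in_mon L' u == colon_mon C L u & in_mon L u == colon_mon C L' u]) ->
  directly_linked (supp_in (in_mon L)) (supp_in (in_mon L')).
Proof.
move=> p0 q0 r0 C nL nL' H; split.
- by split; [apply: supp_in_ideal|apply: supp_in_proper].
- by split; [apply: supp_in_ideal|apply: supp_in_proper].
exists (supp_in (in_mon C)); split; first exact: powers_complete_intersection.
- by move=> x Cx u /Cx; case/and4P: (H u) => /implyP.
- by move=> x Cx u /Cx; case/and4P: (H u) => _ /implyP.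
- rewrite colon_monP -(@supp_in_ext (in_mon L')) // => u.
  by case/and4P: (H u) => _ _ /eqP.
- rewrite colon_monP -(@supp_in_ext (in_mon L)) // => u.
  by case/and4P: (H u) => _ _ _ /eqP.
Qed.

Definition gensI : seq expt :=
  [:: (3, 0, 0); (0, 3, 0); (0, 0, 3); (0, 1, 2); (2, 1, 1); (2, 2, 0)]%N.
Definition gensJ : seq expt :=
  [:: (3, 0, 0); (0, 3, 0); (0, 0, 3); (0, 1, 2); (2, 0, 2); (2, 2, 0)]%N.

Lemma idealIE : @idealI k = supp_in (in_mon gensI).
Proof.
rewrite -ideal_gen_mon /idealI /= !monE /= !expr0 !expr1.
by rewrite !mulr1 !mul1r.
Qed.

Lemma idealJE : @idealJ k = supp_in (in_mon gensJ).
Proof.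
rewrite -ideal_gen_mon /idealJ /= !monE /= !expr0 !expr1.
by rewrite !mulr1 !mul1r.
Qed.

(* Two basic double links: idealI = (a^3, b^3, c^3) + b (c^2, a^2 c, a^2 b), and
   (a^3, b^2, c^3) + (c^2, a^2 c, a^2 b) = (a^3, b^2, c^2) + a^2 (b, c). *)
Lemma licci_idealI : licci (@idealI k).
Proof.
rewrite idealIE.
(* The two double links meet at [L2]. [L1] and [L3] are the ideals halfway: [(a^3, b^3, c^3) : I]
   and [(a^3, b^2, c^2) : L2]. *)
pose L1 : seq expt := [:: (3, 0, 0); (0, 2, 0); (0, 0, 3); (1, 0, 1); (0, 1, 2)]%N.
pose L2 : seq expt := [:: (3, 0, 0); (0, 2, 0); (0, 0, 2); (2, 0, 1); (2, 1, 0)]%N.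
pose L3 : seq expt := [:: (1, 0, 0); (0, 2, 0); (0, 0, 2); (0, 1, 1)]%N.
exists (supp_in (in_mon (powers 1 1 1))); first exact: powers_complete_intersection.
apply: rt_trans; [apply: rt_step; apply: (@mon_directly_linked 3 3 3 _ L1) => //|].
  (* No generator has an exponent above 3, so all exponents from 3 on behave alike and 64 cases
     decide. *)
  by apply: forall_expt; do 3![case=> [|[|[|?]]] //].
apply: rt_trans; [apply: rt_step; apply: (@mon_directly_linked 3 2 3 _ L2) => //|].
  by apply: forall_expt; do 3![case=> [|[|[|?]]] //].
apply: rt_trans; [apply: rt_step; apply: (@mon_directly_linked 3 2 2 _ L3) => //|].
  by apply: forall_expt; do 3![case=> [|[|[|?]]] //].
apply: rt_step; apply: (@mon_directly_linked 1 2 2) => //.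
by apply: forall_expt; do 3![case=> [|[|[|?]]] //].
Qed.

End Monomials.

(** * The invariant of J *)

Definition cubes : seq expt := powers 3 3 3.
Definition gensM : seq expt :=
  [:: (0, 1, 1); (1, 0, 1); (0, 0, 3); (0, 3, 0); (1, 2, 0); (3, 0, 0)]%N.
Definition quotM : seq expt :=
  [seq u <- [seq (ij, l) | ij <- [seq (i, j) | i <- iota 0 3, j <- iota 0 3], l <- iota 0 3] |
     in_mon gensM u && ~~ in_mon cubes u].

Definition unit_expts : seq expt := [:: (1, 0, 0); (0, 1, 0); (0, 0, 1)]%N.

(* Let C = (a^3, b^3, c^3) and M = C : J; the monomials in quotM form a basis of
   M/C.  The balanced forms on J x M of degree t correspond to the functions on
   [seq q <- quotM | pairs t q] that are constant along the edges q -- q + e and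
   vanish on some components; each entry (t, q) of the table gives the component
   of q, one on which no vanishing is imposed.  These are 55 of the 60 such
   components. *)
Definition pairs (t q : expt) := tdiv q t && in_mon gensJ (tsub t q).

Definition adjacent (q q' : expt) :=
  has (fun e => (tadd q e == q') || (tadd q' e == q)) unit_expts.

Definition component (t q : expt) : seq expt :=
  iter 9 (fun S => [seq q' <- quotM |
    pairs t q' && has (fun s => (s == q') || adjacent s q') S]) [:: q].

Definition form_table : seq (expt * expt) :=
  [::((0, 1, 4), (0, 1, 1)); ((0, 1, 5), (0, 1, 1)); ((0, 2, 3), (0, 1, 1));
   ((0, 2, 4), (0, 1, 1)); ((0, 3, 3), (0, 1, 1)); ((0, 4, 1), (0, 1, 1));
   ((0, 4, 2), (0, 1, 1)); ((0, 5, 1), (0, 1, 1)); ((0, 5, 2), (0, 1, 1));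
   ((1, 0, 4), (1, 0, 1)); ((1, 0, 5), (1, 0, 1)); ((1, 1, 3), (1, 0, 1));
   ((1, 1, 4), (0, 1, 1)); ((1, 2, 3), (0, 1, 1)); ((1, 2, 3), (1, 2, 0));
   ((1, 3, 1), (1, 0, 1)); ((1, 3, 2), (1, 0, 1)); ((1, 3, 2), (1, 2, 0));
   ((1, 4, 1), (0, 1, 1)); ((1, 4, 2), (0, 1, 1)); ((1, 5, 0), (1, 2, 0));
   ((1, 5, 1), (0, 1, 1)); ((2, 0, 4), (1, 0, 1)); ((2, 0, 5), (1, 0, 1));
   ((2, 1, 3), (0, 1, 1)); ((2, 1, 3), (1, 0, 1)); ((2, 1, 4), (0, 1, 1));
   ((2, 2, 3), (0, 1, 1)); ((2, 2, 3), (1, 2, 0)); ((2, 3, 1), (0, 1, 1));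
   ((2, 3, 1), (1, 0, 1)); ((2, 3, 2), (0, 1, 1)); ((2, 3, 2), (1, 0, 1));
   ((2, 3, 2), (1, 2, 0)); ((2, 4, 1), (0, 1, 1)); ((2, 5, 0), (1, 2, 0));
   ((3, 0, 3), (1, 0, 1)); ((3, 1, 1), (0, 1, 1)); ((3, 1, 2), (0, 1, 1));
   ((3, 2, 1), (0, 1, 1)); ((3, 2, 1), (1, 0, 1)); ((3, 2, 2), (0, 1, 1));
   ((3, 2, 2), (1, 0, 1)); ((3, 2, 2), (1, 2, 0)); ((3, 4, 0), (1, 2, 0));
   ((4, 0, 1), (1, 0, 1)); ((4, 0, 2), (1, 0, 1)); ((4, 1, 1), (0, 1, 1));
   ((4, 1, 2), (0, 1, 1)); ((4, 2, 0), (1, 2, 0)); ((4, 2, 1), (0, 1, 1));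
   ((5, 0, 1), (1, 0, 1)); ((5, 0, 2), (1, 0, 1)); ((5, 1, 1), (0, 1, 1));
   ((5, 2, 0), (1, 2, 0))]%N.

Definition forms := [seq (tq.1, component tq.1 tq.2) | tq <- form_table].

(** For each variable [e], the two lists index the terms of [form tS (e * x) y] and of
    [form tS x (e * y)] that can be nonzero, the second after the substitution of [q - e] for [q].
    Their agreement is balancedness for [e]. *)
Definition balanced_data (tS : expt * seq expt) :=
  all (fun q => [&& q \in quotM & pairs tS.1 q]) tS.2 && uniq tS.2 &&
  all (fun e => perm_eq
    [seq q <- tS.2 | tdiv e (tsub tS.1 q) && in_mon gensJ (tsub (tsub tS.1 q) e)]
    [seq tsub q e | q <- [seq q <- tS.2 | tdiv e q && in_mon gensM (tsub q e)]])
  unit_expts.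

Lemma forms_balanced : all balanced_data forms.
Proof. by vm_compute. Qed.

(** At the pair of monomials with exponents [t_i - q_i] and [q_i], the [j]-th form takes the value 1
    if [i = j] and 0 otherwise. This gives independence over any field. *)
Lemma forms_separated :
  all (fun i => all (fun j => let tq := nth (0, 0, 0, (0, 0, 0))%N form_table i in
     let tS := nth (0, 0, 0, [::])%N forms j in
     ((tq.2 \in tS.2) && (tsub tS.1 tq.2 == tsub tq.1 tq.2)) == (i == j))
     (iota 0 55)) (iota 0 55).
Proof. by vm_compute. Qed.

Lemma size_forms : size forms = 55. Proof. by []. Qed.

Section ExcessJ.
Variable k : fieldType.
Local Notation R := {mpoly k[3]}.
Implicit Types (x y z r : R) (t u q e : expt).

Lemma coefZ c x u : coef (c *: x) u = c * coef x u.
Proof. exact: mcoeffZ. Qed.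

Lemma coefD x y u : coef (x + y) u = coef x u + coef y u.
Proof. exact: mcoeffD. Qed.

Lemma coef_sum n (F : 'I_n -> R) u : coef (\sum_i F i) u = \sum_i coef (F i) u.
Proof. exact: raddf_sum. Qed.

(** The part of the coefficient of [x * y] at the exponent [tS.1] that comes from the splittings
    whose second factor lies in [tS.2]. *)
Definition form (tS : expt * seq expt) x y : k :=
  \sum_(q <- tS.2) coef x (tsub tS.1 q) * coef y q.

Lemma form_linear1 tS y (M : R -> Prop) : linear_on M (fun x => form tS x y).
Proof.
move=> c x x' _ _; rewrite /form mulr_sumr -big_split; apply: eq_bigr => q _ /=.
by rewrite coefD coefZ; ring.
Qed.

Lemma form_linear2 tS x (M : R -> Prop) : linear_on M (form tS x).
Proof.
move=> c y y' _ _; rewrite /form mulr_sumr -big_split; apply: eq_bigr => q _ /=.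
by rewrite coefD coefZ; ring.
Qed.

Lemma form_balanced_unit tS e x y : balanced_data tS -> e \in unit_expts ->
  supp_in (in_mon gensJ) x -> supp_in (in_mon gensM) y ->
  form tS (mon k e * x) y = form tS x (mon k e * y).
Proof.
case: tS => t S /andP[/andP[/allP SP uS] /allP SE] eU Jx My.
have := SE _ eU; rewrite /= => perm_e.
pose G q := coef x (tsub (tsub t q) e) * coef y q.
transitivity (\sum_(q <- [seq q <- S | tdiv e (tsub t q) && in_mon gensJ (tsub (tsub t q) e)]) G q).
  rewrite big_filter [RHS]big_mkcond; apply: eq_bigr => q _.
  rewrite /G mulrC [mon k e * x]mulrC coef_monM; case: ifP => /= _; last by rewrite mulr0.
  case: ifPn => [_|nJ]; first by rewrite mulrC.
  by rewrite (supp_inP Jx nJ) mulr0.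
rewrite (perm_big _ perm_e) big_map big_filter big_mkcond; apply: eq_bigr => q _.
rewrite /G [mon k e * y]mulrC coef_monM; case: ifPn => [/andP[eq _]|].
  rewrite eq; congr (coef x _ * _).
  move: t q e eq {SP uS SE eU perm_e G} => [[t1 t2] t3] [[q1 q2] q3] [[e1 e2] e3].
  by move=> /and3P[/= ? ? ?]; congr (_, _, _) => /=; lia.
case: ifP => /= _; last by rewrite mulr0.
by move=> nM; rewrite (supp_inP My nM) mulr0.
Qed.

(** The multipliers [r] for which this holds are closed under products and linear combinations, so
    the variables suffice. *)
Lemma form_balanced tS r x y : balanced_data tS ->
  supp_in (in_mon gensJ) x -> supp_in (in_mon gensM) y ->
  form tS (r * x) y = form tS x (r * y).
Proof.
move=> dS.
pose H r := forall x y, supp_in (in_mon gensJ) x -> supp_in (in_mon gensM) y ->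
  form tS (r * x) y = form tS x (r * y).
move: x y; rewrite -/(H r).
have iJ := supp_in_ideal k gensJ; have iM := supp_in_ideal k gensM.
have HM s s' : H s -> H s' -> H (s * s').
  move=> Hs Hs' x y Jx My; rewrite -mulrA Hs //; last exact: (idealMl _ iJ).
  by rewrite Hs' ?mulrA // ?[s' * s]mulrC //; exact: (idealMl _ iM).
have HX s n : H s -> H (s ^+ n).
  by move=> Hs; elim: n => [|n IH]; [move=> x y; rewrite !mul1r|rewrite exprS; apply: HM].
have He e : e \in unit_expts -> H (mon k e).
  by move=> eU x y; apply: form_balanced_unit.
apply: (@supp_in_induct _ predT) => // [x y _ _|c s s' Hs Hs' x y Jx My|u _].
- rewrite !mul0r /form !big1 // => q _; first by rewrite /coef mcoeff0 mulr0.
  by rewrite /coef mcoeff0 mul0r.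
- have lin1 := @form_linear1 tS y (fun=> True); have lin2 := @form_linear2 tS x (fun=> True).
  by rewrite !mulrDl -!scalerAl lin1 // lin2 // Hs // Hs'.
- have := (He (1, 0, 0)%N isT, He (0, 1, 0)%N isT, He (0, 0, 1)%N isT).
  rewrite !monE /= !expr0 !expr1 !mulr1 !mul1r => -[[Ha Hb] Hc].
  by apply: (HM _ _ (HM _ _ _ _)); apply: HX.
Qed.

Lemma mem_quotM u : (u \in quotM) = in_mon gensM u && ~~ in_mon cubes u.
Proof.
rewrite mem_filter andb_idr // => /andP[_]; case: u => [[i j] l] ncubes.
have [lti ltj ltl] : [/\ (i < 3)%N, (j < 3)%N & (l < 3)%N].
  by move: ncubes; rewrite /in_mon /tdiv /=; split; lia.
apply/allpairsP; exists ((i, j), l); rewrite mem_iota; split=> //.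
by apply/allpairsP; exists (i, j); rewrite !mem_iota.
Qed.

Lemma colon_cubes : colon (supp_in (k := k) (in_mon cubes)) (supp_in (in_mon gensJ))
  = supp_in (in_mon gensM).
Proof.
rewrite colon_monP; apply: supp_in_ext.
move=> u; apply/eqP; move: u; apply: forall_expt.
by do 3![case=> [|[|[|?]]] //].
Qed.

Lemma has_excess_idealJ : has_excess (@idealJ k).
Proof.
rewrite idealJE; split; first exact: supp_in_ideal.
pose f := (mon k (3, 0, 0)%N, mon k (0, 3, 0)%N, mon k (0, 0, 3)%N).
have fE : vec_ideal f = supp_in (in_mon cubes) by exact: (@ideal_gen_mon k cubes).
exists f; split; first exact: powers_regular.
  rewrite fE => x Cx u /Cx.
  by case: u => [[i j] l]; rewrite /in_mon /tdiv /=; lia.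
rewrite fE.
have sz : size quotM = 18 by [].
have uQ : uniq quotM by [].
pose Q (i : 'I_18) := nth (0, 0, 0)%N quotM i.
have QP i : Q i \in quotM by rewrite mem_nth // sz.
have Q_inj i j : (Q i == Q j) = (i == j) by rewrite nth_uniq ?sz.
have F_data i : balanced_data (nth (0, 0, 0, [::])%N forms (i : 'I_55)).
  by move/allP: forms_balanced; apply; rewrite mem_nth // size_forms.
(* The strict inequality required is [3 * 18 = 54 < 55]. *)
exists 18, 55, (fun i => mon k (Q i)), (fun i => form (nth (0, 0, 0, [::])%N forms i)).
rewrite colon_cubes; split=> //.
- have coefQ (c : 'I_18 -> k) u :
      coef (\sum_i c i *: mon k (Q i)) u = \sum_i c i * (Q i == u)%:R.
    by rewrite coef_sum; apply: eq_bigr => i _; rewrite coefZ coef_mon.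
  have coefQi c i : coef (\sum_i c i *: mon k (Q i)) (Q i) = c i.
    rewrite coefQ (bigD1 i) //= eqxx mulr1 big1 ?addr0 // => j /negPf.
    by rewrite -Q_inj => ->; rewrite mulr0.
  split=> [i|c Cc i|x Mx].
  + by apply/supp_in_mon; have := QP i; rewrite mem_quotM => /andP[].
  + rewrite -(coefQi c i); apply: (supp_inP Cc).
    by have := QP i; rewrite mem_quotM => /andP[].
  + exists (fun i => coef x (Q i)) => u; apply: contraNT => nCu.
    have [Qu|nQu] := boolP (u \in quotM).
      have lti : (index u quotM < 18)%N by move: Qu; rewrite -index_mem sz.
      have -> : u = Q (Ordinal lti) by rewrite /Q nth_index.
      by rewrite /coef mcoeffB -!/(coef _ _) coefQi subrr.
    rewrite /coef mcoeffB -!/(coef _ _) coefQ (@supp_inP _ (in_mon gensM) x) //; last first.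
      by move: nQu; rewrite mem_quotM nCu andbT.
    rewrite big1 ?subrr // => i _; case: eqP => [e|]; last by rewrite mulr0.
    by rewrite -e QP in nQu.
- move=> i; split.
  + by move=> y _; apply: form_linear1.
  + by move=> x _; apply: form_linear2.
  + by move=> r x y Jx My; apply: form_balanced.
  + move=> x y _ Cy; rewrite /form big_seq big1 // => q qS.
    rewrite (supp_inP Cy) ?mulr0 //.
    have /andP[/andP[/allP SP _] _] := F_data i.
    by have /andP[] := SP _ qS; rewrite mem_quotM => /andP[].
- move=> c cF i.
  set tq := nth (0, 0, 0, (0, 0, 0))%N form_table i.
  have sep j : let tS := nth (0, 0, 0, [::])%N forms (j : 'I_55) in
     (tq.2 \in tS.2) && (tsub tS.1 tq.2 == tsub tq.1 tq.2) = (i == j).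
    have /allP/(_ (i : nat)) := forms_separated; rewrite mem_iota ltn_ord => /(_ isT).
    move=> /allP/(_ (j : nat)); rewrite mem_iota ltn_ord => /(_ isT) /=.
    by rewrite -/tq => /eqP ->.
  have fE' : (nth (0, 0, 0, [::])%N forms i).1 = tq.1.
    by rewrite (nth_map (0, 0, 0, (0, 0, 0))%N).
  have := sep i; rewrite eqxx => /andP[qS _].
  have /andP[/andP[/allP SP _] _] := F_data i.
  have /andP[qQ /andP[_ Jtq]] := SP _ qS; rewrite fE' in Jtq.
  rewrite mem_quotM in qQ; have /andP[Mq _] := qQ.
  rewrite -[RHS](cF (mon k (tsub tq.1 tq.2)) (mon k tq.2)); last 2 first.
  + exact/supp_in_mon.
  + exact/supp_in_mon.
  have formE j : form (nth (0, 0, 0, [::])%N forms (j : 'I_55))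
      (mon k (tsub tq.1 tq.2)) (mon k tq.2) = (i == j)%:R.
    rewrite -sep /form /=; set tS := nth _ _ _.
    have /andP[/andP[_ uS] _] := F_data j.
    under eq_bigr do rewrite !coef_mon.
    have [qSj|nqSj] /= := boolP (tq.2 \in tS.2).
      rewrite (bigD1_seq _ qSj uS) /= eqxx mulr1 big1 ?addr0 1?eq_sym //.
      by move=> q' /negPf; rewrite eq_sym => ->; rewrite mulr0.
    rewrite big_seq big1 // => q' q'S; case: (tq.2 =P q') => [e|]; last by rewrite mulr0.
    by rewrite e q'S in nqSj.
  rewrite (bigD1 i) //= formE eqxx mulr1 big1 ?addr0 // => j.
  by rewrite formE eq_sym => /negPf ->; rewrite mulr0.
Qed.

End ExcessJ.

(** * Exactness of complexes of monomial matrices *)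

(** The rank is at most the cardinality, for [P] and for its complement. The two diagonal matrices
    add up to the identity, which forces equality. *)
Lemma rank_diag_pred (F : fieldType) n (P : pred 'I_n) :
  \rank (diag_mx (\row_s (P s)%:R) : 'M[F]_n) = #|P|.
Proof.
have ub (Q : pred 'I_n) : (\rank (diag_mx (\row_s (Q s)%:R) : 'M[F]_n) <= #|Q|)%N.
  have -> : diag_mx (\row_s (Q s)%:R) = \sum_(s | Q s) delta_mx s s :> 'M[F]_n.
    apply/matrixP => i j; rewrite summxE !mxE; case: (i =P j) => [<-|ne].
      rewrite mulr1n; case Qi: (Q i); last first.
        rewrite big1 // => s Qs; rewrite mxE; case: (i =P s) => // e.
        by rewrite -e Qi in Qs.
      rewrite (bigD1 i) //= mxE !eqxx big1 ?addr0 // => s /andP[_ /negPf ne].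
      by rewrite mxE eq_sym ne.
    rewrite mulr0n big1 // => s _; rewrite mxE; case: (i =P s) => //= <-.
    by case: (j =P i) => // e; case: ne.
  rewrite -sum1_card; elim/big_rec2: _ => [|s r A _ IH]; first by rewrite mxrank0.
  apply: leq_trans (mxrank_add _ _) _; rewrite leq_add // mxrank_delta //.
apply/eqP; rewrite eqn_leq ub /=.
have := ub (predC P); have := mxrank_add (diag_mx (\row_s (P s)%:R) : 'M[F]_n)
  (diag_mx (\row_s (predC P s)%:R)).
have -> : diag_mx (\row_s (P s)%:R) + diag_mx (\row_s (predC P s)%:R) = 1%:M :> 'M[F]_n.
  apply/matrixP => i j; rewrite !mxE -mulrnDl; congr (_ *+ _).
  by rewrite /predC /=; case: (P i); rewrite ?addr0 ?add0r.
rewrite mxrank1 => le1 le2; have := cardC P; rewrite card_ord => e.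
by rewrite -(leq_add2r #|predC P|) e; apply: leq_trans le1 _; rewrite leq_add2l.
Qed.

(** A monomial with an integer coefficient: cancellations are computed over the integers, so one
    computation serves every field. *)
Definition term : Type := int * expt.
Definition ent (D : seq (seq term)) i j : term := nth (0, (0, 0, 0)%N) (nth [::] D i) j.

Section MonomialMatrices.
Variable k : fieldType.
Local Notation R := {mpoly k[3]}.

Definition tpoly (e : term) : R := e.1%:~R *: mon k e.2.

Definition dmx (D : seq (seq term)) m n : 'M[R]_(m, n) :=
  \matrix_(i, j) tpoly (ent D i j).

Lemma tpoly0 e : e.1 == 0 -> tpoly e = 0.
Proof. by move/eqP; rewrite /tpoly => ->; rewrite scale0r. Qed.

Definition prod_terms D D' n i l : seq term :=
  [seq ((ent D i j).1 * (ent D' j l).1, tadd (ent D i j).2 (ent D' j l).2) | j <- iota 0 n].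

Definition cancels (s : seq term) :=
  all (fun u => foldr (fun e c => if e.2 == u then e.1 + c else c) 0 s == 0) [seq e.2 | e <- s].

Lemma cancels_sum s : cancels s -> \sum_(e <- s) tpoly e = 0.
Proof.
move=> /allP cs; apply/mpolyP => m; have [u ->] := mm_onto m; rewrite mcoeff0 raddf_sum /=.
have E s' : \sum_(e <- s') (tpoly e)@_(mm u) =
    (foldr (fun e c => if e.2 == u then e.1 + c else c) 0 s')%:~R.
  elim: s' => [|e s' IH]; first by rewrite big_nil.
  rewrite big_cons IH /= /tpoly mcoeffZ -/(coef _ _) coef_mon.
  by case: eqP => _; rewrite ?mulr1 ?mulr0 ?add0r // intrD.
rewrite E; have [us|nus] := boolP (u \in [seq e.2 | e <- s]).
  by move/eqP: (cs _ us) => ->.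
elim: s nus {cs E} => //= e s IH; rewrite inE negb_or => /andP[ne /IH].
by rewrite eq_sym (negPf ne).
Qed.

Lemma tpolyM e e' : tpoly e * tpoly e' = tpoly (e.1 * e'.1, tadd e.2 e'.2).
Proof. by rewrite /tpoly /= monD intrM -scalerAl -scalerAr scalerA. Qed.

Definition check_complex D D' m n p :=
  all (fun i => all (fun l => cancels (prod_terms D D' n i l)) (iota 0 p)) (iota 0 m).

Lemma check_complexP D D' m n p : check_complex D D' m n p ->
  dmx D m n *m dmx D' n p = 0.
Proof.
move=> /allP H; apply/matrixP => i l; rewrite !mxE.
have /H/allP/(_ (l : nat)) : (i : nat) \in iota 0 m by rewrite mem_iota ltn_ord.
rewrite mem_iota ltn_ord => /(_ isT)/cancels_sum e; rewrite -[RHS]e.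
rewrite big_map (_ : iota 0 n = index_iota 0 n) ?big_mkord; last by rewrite /index_iota subn0.
by apply: eq_bigr => j _; rewrite !mxE tpolyM.
Qed.

(** Descending induction on the last nonzero coordinate of a cycle: a boundary with the same last
    coordinate, and zeros after it, is subtracted. *)
Lemma triangular_exact m n p (d : 'M[R]_(m, n)) (d' : 'M[R]_(n, p)) :
  d *m d' = 0 ->
  (forall (j : 'I_n) (u : 'rV_n), u *m d' = 0 -> (forall i : 'I_n, (j < i)%N -> u 0 i = 0) ->
     exists v : 'rV_m, (v *m d) 0 j = u 0 j /\
       forall i : 'I_n, (j < i)%N -> (v *m d) 0 i = 0) ->
  forall u : 'rV_n, u *m d' = 0 <-> exists v : 'rV_m, u = v *m d.
Proof.
move=> dd' H u; split=> [|[v ->]]; last by rewrite -mulmxA dd' mulmx0.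
suff {u} S j (u : 'rV_n) : u *m d' = 0 -> (forall i : 'I_n, (j <= i)%N -> u 0 i = 0) ->
    exists v : 'rV_m, u = v *m d.
  by move=> ud'; apply: (S n) => // i; rewrite leqNgt ltn_ord.
elim: j u => [|j IH] u ud' u0.
  by exists 0; rewrite mul0mx; apply/rowP => i; rewrite u0 // mxE.
have [ltjn|lenj] := ltnP j n; last first.
  by apply: IH => // i lei; have := ltn_ord i; rewrite ltnNge (leq_trans lenj lei).
have [v [ej e0]] := H (Ordinal ltjn) u ud' u0.
have [||w ew] := IH (u - v *m d).
- by rewrite mulmxBl ud' -mulmxA dd' mulmx0 subrr.
- move=> i; rewrite leq_eqVlt !mxE => /orP[/eqP eji|ltji].
    have -> : i = Ordinal ltjn by apply: val_inj.
    by rewrite -ej !mxE subrr.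
  by have := e0 _ ltji; rewrite u0 // !mxE => ->; rewrite subr0.
by exists (w + v); rewrite mulmxDl -ew subrK.
Qed.

Definition leads D n r j := all (fun i => (ent D r i).1 == 0) (iota j.+1 (n - j.+1)).

Lemma leadsP D m n (r : 'I_m) (j i : 'I_n) : leads D n r j -> (j < i)%N -> dmx D m n r i = 0.
Proof.
move=> /allP H ltji; rewrite mxE tpoly0 // H // mem_iota.
by have := ltn_ord i; lia.
Qed.

Definition mon_column (gs : seq expt) : seq (seq term) := [seq [:: (1, g)] | g <- gs].

Lemma ent_mon_column gs i : (i < size gs)%N ->
  ent (mon_column gs) i 0 = (1, nth (0, 0, 0)%N gs i).
Proof. by move=> lti; rewrite /ent (nth_map (0, 0, 0)%N). Qed.

Definition lead_rows D m n j := [seq r <- iota 0 m | ((ent D r j).1 == 1) && leads D n r j].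

(** The last coefficient of a relation between [g_0, ..., g_j] lies in [(g_0, ..., g_(j-1)) : g_j].
    It can be cancelled once this monomial ideal is generated by the last entries of the rows of [D]
    that end in column [j]. *)
Lemma mon_syzygies_exact gs D m n : size gs = n ->
  check_complex D (mon_column gs) m n 1 ->
  (forall j, (j < n)%N -> forall t, in_mon (take j gs) (tadd (nth (0, 0, 0)%N gs j) t) ->
     in_mon [seq (ent D r j).2 | r <- lead_rows D m n j] t) ->
  forall u : 'rV_n, u *m dmx (mon_column gs) n 1 = 0 <-> exists v : 'rV_m, u = v *m dmx D m n.
Proof.
move=> szn cD colon_j; apply: triangular_exact; first exact: check_complexP.
move=> j u ud u0; set g := nth (0, 0, 0)%N gs.
have usum : \sum_i u 0 i * mon k (g i) = 0.
  have /matrixP/(_ 0 0) := ud; rewrite !mxE => e; rewrite -[RHS]e; apply: eq_bigr => i _.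
  by rewrite mxE ent_mon_column ?szn // /tpoly scale1r.
have uj : supp_in (in_mon (take j gs)) (u 0 j * mon k (g j)).
  have iT := supp_in_ideal k (take j gs).
  have -> : u 0 j * mon k (g j) = - \sum_(i < n | i != j) u 0 i * mon k (g i).
    by apply/eqP; rewrite -addr_eq0 -[X in _ == X]usum [X in _ == X](bigD1 j).
  apply: (idealN iT); apply: (ideal_sum iT) => i neij.
  have [ltij|] := ltnP i j; last first.
    rewrite leq_eqVlt => /orP[/eqP e|ltji]; first by case/eqP: neij; apply: val_inj.
    by rewrite u0 // mul0r; apply: (ideal0 iT).
  apply: (idealMl _ iT); apply/supp_in_mon/hasP; exists (g i); last by rewrite /tdiv !leqnn.
  rewrite /g -(nth_take _ ltij); apply: mem_nth.
  by rewrite size_take szn ltn_ord.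
pose L := lead_rows D m n j.
have {uj} [x ux] : ideal_gen [seq mon k t | t <- [seq (ent D r j).2 | r <- L]] (u 0 j).
  by rewrite ideal_gen_mon => t /((supp_in_monM _ _ _).1 uj); apply: colon_j.
set s := [seq mon k t | t <- _] in x ux.
have szs : size s = size L by rewrite !size_map.
have LP r : r \in L -> [/\ (r < m)%N, (ent D r j).1 = 1 & leads D n r j].
  by rewrite mem_filter mem_iota => /andP[/andP[/eqP -> ->]].
have ltm (l : 'I_(size s)) : (nth 0%N L l < m)%N.
  by have [] // := LP (nth 0%N L l); apply: mem_nth; rewrite -szs.
pose row_l (l : 'I_(size s)) := Ordinal (ltm l).
have vE i : ((\sum_l x l *: delta_mx 0 (row_l l) : 'rV_m) *m dmx D m n) 0 i =
    \sum_l x l * dmx D m n (row_l l) i.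
  rewrite mulmx_suml summxE; apply: eq_bigr => l _.
  by rewrite -scalemxAl -rowE !mxE.
exists (\sum_l x l *: delta_mx 0 (row_l l)); split=> [|i ltji]; rewrite vE.
  rewrite ux; apply: eq_bigr => l _; congr (_ * _).
  have ltl : (l < size L)%N by rewrite -szs.
  rewrite mxE /s (nth_map (0, 0, 0)%N); last by move: ltl; rewrite -(size_map (fun r => (ent D r j).2) L).
  rewrite (nth_map 0%N) // /tpoly.
  by have [_ -> _] := LP _ (mem_nth 0%N ltl); rewrite scale1r.
rewrite big1 // => l _; rewrite (@leadsP _ _ _ _ j) ?mulr0 //.
by have [] // := LP (nth 0%N L l); apply: mem_nth; rewrite -szs.
Qed.

Definition unit_entry (e : term) := (e.1 == 1) || (e.1 == -1).
Definition coprime_expt (t u : expt) :=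
  [&& minn t.1.1 u.1.1 == 0, minn t.1.2 u.1.2 == 0 & minn t.2 u.2 == 0]%N.

Definition column_support D' j c (S : seq nat) :=
  all (fun i => (i \in S) || ((ent D' i c).1 == 0)) (iota 0 j.+1).

(* Some column of D' shows that the last nonzero coefficient of a relation between
   the rows of D' is not the j-th one, or that it is a multiple of the j-th entry
   of a row of D, by the Koszul relation between two coprime monomials. *)
Definition check_exact_at D D' m n p j :=
  has (fun c => unit_entry (ent D' j c) &&
    (column_support D' j c [:: j] ||
     has (fun i => [&& unit_entry (ent D' i c), column_support D' j c [:: i; j],
       coprime_expt (ent D' i c).2 (ent D' j c).2 &
       has (fun r => [&& unit_entry (ent D r j), (ent D r j).2 == (ent D' i c).2
                     & leads D n r j]) (iota 0 m)]) (iota 0 j))) (iota 0 p).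

Lemma unit_entryP e : unit_entry e -> exists2 s : R, s * s = 1 & tpoly e = s * mon k e.2.
Proof.
by rewrite /tpoly => /orP[]/eqP ->; [exists 1|exists (-1)];
  rewrite ?mulrNN ?mulr1 ?scaleN1r ?scale1r ?mulN1r ?mul1r.
Qed.

Lemma check_exactP D D' m n p : check_complex D D' m n p ->
  all (check_exact_at D D' m n p) (iota 0 n) ->
  forall u : 'rV_n, u *m dmx D' n p = 0 <-> exists v : 'rV_m, u = v *m dmx D m n.
Proof.
move=> cD /allP cE; apply: triangular_exact; first exact: check_complexP.
move=> j u ud u0.
have /cE/hasP[c] : (j : nat) \in iota 0 n by rewrite mem_iota ltn_ord.
rewrite mem_iota => /= ltcp /andP[/unit_entryP [s ss entj]].
have csum : \sum_i u 0 i * tpoly (ent D' i c) = 0.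
  have /matrixP/(_ 0 (Ordinal ltcp)) := ud; rewrite !mxE => e; rewrite -[RHS]e.
  by apply: eq_bigr => i _; rewrite mxE.
have vanish S (i : 'I_n) : column_support D' j c S -> (i : nat) \notin S ->
    u 0 i * tpoly (ent D' i c) = 0.
  move=> /allP cs niS; have [ltji|leij] := ltnP j i; first by rewrite u0 ?mul0r.
  have /cs : (i : nat) \in iota 0 j.+1 by rewrite mem_iota.
  by rewrite (negPf niS) /= => /tpoly0 ->; rewrite mulr0.
case/orP=> [cs|/hasP[i]].
  exists 0; rewrite mul0mx; split=> [|i _]; rewrite mxE //; apply/esym.
  have /eqP : u 0 j * tpoly (ent D' j c) = 0.
    rewrite -[RHS]csum (bigD1 j) //= big1 ?addr0 // => i neij.
    by apply: vanish cs _; rewrite inE.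
  rewrite entj mulrCA mulf_eq0 => /orP[/eqP s0|].
    by move/eqP: ss; rewrite s0 mulr0 eq_sym oner_eq0.
  by rewrite mulf_eq0 (negPf (mon_neq0 _ _)) orbF => /eqP.
rewrite mem_iota => /= ltij /and4P[/unit_entryP [s' s's' enti] cs cop /hasP[r]].
rewrite mem_iota => /= ltrm /and3P[/unit_entryP [s'' s''s'' entr] /eqP er lr].
have ltin : (i < n)%N by apply: ltn_trans ltij (ltn_ord j).
pose io := Ordinal ltin.
have neij : io != j by rewrite -val_eqE /= neq_ltn ltij.
have two : u 0 io * tpoly (ent D' i c) + u 0 j * tpoly (ent D' j c) = 0.
  rewrite -[RHS]csum (bigD1 io) //= (bigD1 j) 1?eq_sym //= big1 ?addr0 // => l /andP[nl1 nl2].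
  by apply: vanish cs _; rewrite !inE negb_or -!(val_eqE l) in nl1 nl2 *; rewrite nl1.
rewrite enti entj in two.
(* The relation [two] reads [s' u_i g_i + s u_j g_j = 0] with coprime monomials, so [g_i] divides
   [u_j]. *)
have [w ew] : exists w, u 0 j = w * mon k (ent D' i c).2.
  apply: (@mon_divides _ (ent D' j c).2 _ _ (- (s * s' * u 0 io))).
    move: cop; rewrite /coprime_expt; case: (ent D' i c).2 => [[a1 a2] a3].
    case: (ent D' j c).2 => [[b1 b2] b3] /and3P[/= ? ? ?] [[t1 t2] t3].
    by rewrite /tdiv /=; lia.
  apply/eqP; rewrite -subr_eq0; apply/eqP.
  transitivity (s * (u 0 io * (s' * mon k (ent D' i c).2) +
      u 0 j * (s * mon k (ent D' j c).2))); last by rewrite two mulr0.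
  by rewrite mulrDr [X in _ = _ + X](_ : _ = (s * s) * (u 0 j * mon k (ent D' j c).2));
    [rewrite ss; ring|ring].
exists ((w * s'') *: delta_mx 0 (Ordinal ltrm)); split=> [|l ltjl].
  rewrite -scalemxAl -rowE !mxE /= entr ew er.
  have -> : w * s'' * (s'' * mon k (ent D' i c).2) = (s'' * s'') * w * mon k (ent D' i c).2.
    by ring.
  by rewrite s''s'' mul1r.
have := leadsP (r := Ordinal ltrm) lr ltjl; rewrite -scalemxAl -rowE !mxE => ->.
by rewrite mulr0.
Qed.

End MonomialMatrices.

(** * The resolutions *)

(** All differentials vanish after tensoring with [k], so each graded component of the complex is
    its own homology. *)
Lemma minimal_tor_dim (k : fieldType) n (F : free_data k n) :
  (forall i, fr_diffk F i = 0) ->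
  forall i j, fr_tor_dim F i j = #|[pred s : 'I_(fr_rank F i) | fr_deg s == j]|.
Proof.
move=> minF i j; rewrite /fr_tor_dim /fr_boundaries minF mulmx0 mxrank0 subn0.
rewrite -(rank_diag_pred k); case: i => [|i] //=; rewrite minF.
have full : row_full (kermx (0 : 'M[k]_(fr_rank F i.+1, fr_rank F i))).
  by rewrite /row_full mxrank_ker mxrank0 subn0.
apply/eqP; rewrite eqn_leq mxrankS ?capmxSl //= mxrankS // sub_capmx submx_refl.
exact: submx_full.
Qed.

Lemma card_nth_pred (T : Type) (x0 : T) (s : seq T) (P : pred T) :
  #|[pred i : 'I_(size s) | P (nth x0 s i)]| = count P s.
Proof. by rewrite -sum1_card -sum1_count (big_nth x0) big_mkord. Qed.

Definition tdeg (t : expt) := (t.1.1 + t.1.2 + t.2)%N.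

Lemma mdeg_mm t : mdeg (mm t) = tdeg t.
Proof. by rewrite mdegE !big_ord_recl big_ord0 !mnmE /= addn0 addnA. Qed.

(** The condition of positive degree makes every entry vanish at the origin, so the same check
    yields homogeneity and minimality. *)
Definition check_degrees D m n (dm dn : seq nat) :=
  all (fun i => all (fun j => ((ent D i j).1 == 0) ||
    (nth 0 dm i == tdeg (ent D i j).2 + nth 0 dn j)%N && (0 < tdeg (ent D i j).2)%N) (iota 0 n)) (iota 0 m).

Section MonomialResolution.
Variable k : fieldType.
Local Notation R := {mpoly k[3]}.

(** Past homological degree 3 the default [[::]] yields modules of rank 0. *)
Definition mon_free_data gs D1 D2 (degs : seq (seq nat)) : free_data k 3 :=
  @FreeData k 3 (fun i => size (nth [::] degs i))
    (fun i s => (nth 0%N (nth [::] degs i) s)%:Z)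
    (fun i => dmx k (nth [::] [:: mon_column gs; D1; D2] i) _ _)
    (const_mx 1).

Variables (gs : seq expt) (D1 D2 : seq (seq term)) (d1 d2 d3 : seq nat).
Let n1 := size d1.
Let n2 := size d2.
Let n3 := size d3.
Let degs := [:: [:: 0%N]; d1; d2; d3].
Let F := mon_free_data gs D1 D2 degs.

Hypotheses (szgs : size gs = n1)
  (deg1 : check_degrees (mon_column gs) n1 1 d1 [:: 0%N])
  (deg2 : check_degrees D1 n2 n1 d2 d1)
  (deg3 : check_degrees D2 n3 n2 d3 d2)
  (cpx1 : check_complex D1 (mon_column gs) n2 n1 1)
  (cpx2 : check_complex D2 D1 n3 n2 n1)
  (ex1 : forall j, (j < n1)%N -> forall t, in_mon (take j gs) (tadd (nth (0, 0, 0)%N gs j) t) ->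
     in_mon [seq (ent D1 r j).2 | r <- lead_rows D1 n2 n1 j] t)
  (ex2 : all (check_exact_at D2 D1 n3 n2 n1) (iota 0 n2))
  (ex3 : all (check_exact_at [::] D2 0 n3 n2) (iota 0 n3)).

Lemma check_degreesP D m n dm dn (i : 'I_m) (j : 'I_n) u : check_degrees D m n dm dn ->
  u \in msupp (dmx k D m n i j) -> (nth 0 dm i = mdeg u + nth 0 dn j)%N /\ (0 < mdeg u)%N.
Proof.
move=> /allP H; have /H/allP/(_ (j : nat)) : (i : nat) \in iota 0 m by rewrite mem_iota ltn_ord.
rewrite mem_iota ltn_ord => /(_ isT); rewrite mxE mcoeff_msupp; have [v ->] := mm_onto u.
case/orP=> [/(tpoly0 k) ->|]; first by rewrite mcoeff0 eqxx.
rewrite /tpoly mcoeffZ -/(coef _ _) coef_mon mdeg_mm.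
move=> /andP[/eqP e lt0]; case: (_ =P v) => [<-|_] //=.
by rewrite mulr0 eqxx.
Qed.

Lemma mon_free_degrees i (s : 'I_(fr_rank F i.+1)) (t : 'I_(fr_rank F i)) u :
  u \in msupp (fr_diff F i s t) ->
  (nth 0 (nth [::] degs i.+1) s = mdeg u + nth 0 (nth [::] degs i) t)%N /\ (0 < mdeg u)%N.
Proof.
case: i s t => [|[|[|i]]] s t.
- exact: (@check_degreesP _ n1 1 _ _ s t u deg1).
- exact: (@check_degreesP _ n2 n1 _ _ s t u deg2).
- exact: (@check_degreesP _ n3 n2 _ _ s t u deg3).
- by case: s => s; rewrite /= nth_nil.
Qed.

Lemma mon_free_homogeneous : fr_homogeneous F.
Proof.
split=> [i s t u /mon_free_degrees [e _]|s u]; first by rewrite /fr_deg /= e PoszD.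
rewrite mxE msupp1 inE => /eqP ->; rewrite mdeg0 /fr_deg /=.
by case: s => [[|s] lts].
Qed.

Lemma mon_free_minimal i : fr_diffk F i = 0.
Proof.
apply/matrixP => s t; rewrite !mxE; apply: memN_msupp_eq0; apply/negP.
move=> H; have [] := @mon_free_degrees i s t 0%MM; last by rewrite mdeg0.
by rewrite /= mxE.
Qed.

Lemma mon_free_exact : fr_exact F (supp_in (in_mon gs)).
Proof.
have iI := supp_in_ideal k gs.
split.
- move=> x; exists (const_mx x); rewrite !mxE big_ord1 !mxE mulr1 subrr.
  exact: (ideal0 iI).
- move=> u; have -> : (u *m fr_aug F) 0 0 = u 0 0 by rewrite mxE big_ord1 mxE mulr1.
  have colE (v : 'rV_n1) : (v *m dmx k (mon_column gs) n1 1) 0 0 =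
      \sum_i v 0 i * mon k (nth (0, 0, 0)%N gs i).
    rewrite mxE; apply: eq_bigr => i _.
    by rewrite mxE ent_mon_column ?szgs // /tpoly scale1r.
  split=> [|[v ->]]; last first.
    rewrite [X in supp_in _ X](colE v).
    apply: (ideal_sum iI) => i _; apply: (idealMl _ iI); apply/supp_in_mon.
    apply/hasP; exists (nth (0, 0, 0)%N gs i); last by rewrite /tdiv !leqnn.
    by rewrite mem_nth ?szgs.
  rewrite -ideal_gen_mon => Iu.
  suff [v ev] : exists v : 'rV_n1, u 0 0 = (v *m dmx k (mon_column gs) n1 1) 0 0.
    by exists v; apply/rowP => i; rewrite [i](ord1 (i : 'I_1)); exact: ev.
  move: (u 0 0) Iu; apply: ideal_gen_sub.
    split=> [|x y [v ->] [w ->]|r x [v ->]].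
    + by exists 0; rewrite mul0mx mxE.
    + by exists (v + w); rewrite mulmxDl [RHS]mxE.
    + by exists (r *: v); rewrite -scalemxAl [RHS]mxE.
  move=> i; rewrite size_map => lti; rewrite (nth_map (0, 0, 0)%N) //.
  have lti' : (i < n1)%N by rewrite -szgs.
  exists (delta_mx 0 (Ordinal lti')); rewrite -rowE !mxE ent_mon_column //.
  by rewrite /tpoly scale1r.
- case=> [|[|[|i]]] u.
  + exact: (mon_syzygies_exact szgs cpx1 ex1).
  + exact: (check_exactP cpx2 ex2).
  (* Injectivity of the last map is exactness against a matrix with no rows. *)
  + apply: (@check_exactP _ [::] _ 0) => //; exact: ex3.
  + have -> : u = 0 by apply/rowP => -[t ltt]; case: (notF); move: ltt; rewrite /= nth_nil.
    by rewrite mul0mx; split=> // _; exists 0; rewrite mul0mx.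
Qed.

Lemma mon_free_betti (I : R -> Prop) beta : I = supp_in (in_mon gs) ->
  (forall i j, beta i j = count (fun d => d%:Z == j) (nth [::] degs i)) ->
  graded_betti_numbers I beta.
Proof.
move=> -> eb; exists F; first by split; [apply: mon_free_homogeneous|apply: mon_free_exact].
by move=> i j; rewrite eb (minimal_tor_dim mon_free_minimal) -(card_nth_pred 0%N).
Qed.

End MonomialResolution.

Definition pos i j l : term := (1, (i, j, l)).
Definition neg i j l : term := (-1, (i, j, l)).
Definition nul : term := (0, (0, 0, 0)%N).

(* The generators are ordered so that each colon ideal (g_1, .., g_(j-1)) : g_j
   is generated by one or two powers of variables; the resolutions are the
   iterated mapping cones. *)
Definition resI_gens : seq expt :=
  [:: (3, 0, 0); (2, 1, 1); (0, 1, 2); (0, 0, 3); (2, 2, 0); (0, 3, 0)]%N.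
Definition resI_diff1 : seq (seq term) :=
  [:: [:: neg 0 1 1; pos 1 0 0; nul; nul; nul; nul];
      [:: nul; neg 0 0 1; pos 2 0 0; nul; nul; nul];
      [:: nul; nul; neg 0 0 1; pos 0 1 0; nul; nul];
      [:: neg 0 0 3; nul; nul; pos 3 0 0; nul; nul];
      [:: nul; neg 0 1 0; nul; nul; pos 0 0 1; nul];
      [:: neg 0 2 0; nul; nul; nul; pos 1 0 0; nul];
      [:: nul; nul; neg 0 2 0; nul; nul; pos 0 0 2];
      [:: nul; nul; nul; nul; neg 0 1 0; pos 2 0 0]].
Definition resI_diff2 : seq (seq term) :=
  [:: [:: pos 0 0 2; pos 1 0 1; pos 3 0 0; neg 0 1 0; nul; nul; nul; nul];
      [:: pos 0 1 0; nul; nul; nul; pos 1 0 0; neg 0 0 1; nul; nul];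
      [:: nul; pos 0 2 0; nul; nul; neg 0 1 1; nul; pos 2 0 0; neg 0 0 2]].

Definition resJ_gens : seq expt :=
  [:: (3, 0, 0); (2, 0, 2); (0, 1, 2); (2, 2, 0); (0, 3, 0); (0, 0, 3)]%N.
Definition resJ_diff1 : seq (seq term) :=
  [:: [:: neg 0 0 2; pos 1 0 0; nul; nul; nul; nul];
      [:: nul; neg 0 1 0; pos 2 0 0; nul; nul; nul];
      [:: nul; nul; neg 2 1 0; pos 0 0 2; nul; nul];
      [:: neg 0 2 0; nul; nul; pos 1 0 0; nul; nul];
      [:: nul; nul; neg 0 2 0; nul; pos 0 0 2; nul];
      [:: nul; nul; nul; neg 0 1 0; pos 2 0 0; nul];
      [:: nul; nul; neg 0 0 1; nul; nul; pos 0 1 0];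
      [:: nul; neg 0 0 1; nul; nul; nul; pos 2 0 0]].
Definition resJ_diff2 : seq (seq term) :=
  [:: [:: pos 0 2 0; pos 1 1 0; pos 1 0 0; neg 0 0 2; nul; nul; nul; nul];
      [:: nul; nul; neg 0 1 0; nul; pos 2 0 0; neg 0 0 2; nul; nul];
      [:: nul; pos 0 0 1; nul; nul; nul; nul; pos 2 0 0; neg 0 1 0]].

Lemma betti_tableE i j : betti_table i j =
  count (fun d : nat => d%:Z == j)
    (nth [::] [:: [:: 0]; [:: 3; 4; 3; 3; 4; 3]; [:: 5; 5; 4; 6; 5; 5; 5; 5]; [:: 7; 6; 7]]%N i).
Proof.
by case: i => [|[|[|[|i]]]]; case: j => [[|[|[|[|[|[|[|[|j]]]]]]]]|j] //; rewrite /= nth_nil.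
Qed.

Section BettiNumbers.
Variable k : fieldType.

Lemma betti_idealI : graded_betti_numbers (@idealI k) betti_table.
Proof.
apply: (@mon_free_betti k resI_gens resI_diff1 resI_diff2
  [:: 3; 4; 3; 3; 4; 3]%N [:: 5; 5; 4; 6; 5; 5; 5; 5]%N [:: 7; 6; 7]%N) => //.
- case=> [|[|[|[|[|[|//]]]]]] _ [[i j] l]; rewrite /in_mon /tdiv /=; lia.
- rewrite idealIE; apply: supp_in_ext => -[[i j] l]; rewrite /in_mon /tdiv /=; lia.
- exact: betti_tableE.
Qed.

Lemma betti_idealJ : graded_betti_numbers (@idealJ k) betti_table.
Proof.
apply: (@mon_free_betti k resJ_gens resJ_diff1 resJ_diff2
  [:: 3; 4; 3; 4; 3; 3]%N [:: 5; 5; 6; 5; 5; 5; 4; 5]%N [:: 7; 7; 6]%N) => //.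
- case=> [|[|[|[|[|[|//]]]]]] _ [[i j] l]; rewrite /in_mon /tdiv /=; lia.
- rewrite idealJE; apply: supp_in_ext => -[[i j] l]; rewrite /in_mon /tdiv /=; lia.
- move=> i j; rewrite betti_tableE.
  (* In each homological degree the shifts for J are a permutation of those for I. *)
  by case: i => [|[|[|[|i]]]]; apply: (elimT seq.permP); rewrite /= ?nth_nil.
Qed.

End BettiNumbers.

Theorem mainTheorem1 (k : fieldType) :
  [/\ graded_betti_numbers (@idealI k) betti_table,
      graded_betti_numbers (@idealJ k) betti_table,
      licci (@idealI k)
    & ~ licci (@idealJ k)].
Proof.
split; [exact: betti_idealI|exact: betti_idealJ|exact: licci_idealI|].
exact/has_excess_not_licci/has_excess_idealJ.
Qed.
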